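(* There exists a smooth, strictly positive, Gaussian-decaying probability density $f$ on $\mathbb R^2$ such that \[ \mathcal I[f]\,\mathcal D[f]-\mathcal Q[f]^2<0. \] Moreover, if $f_t=P_tf$ and $\Phi_f(t):=I(t)I''(t)-I'(t)^2$, where $I(t)$ is the Fisher information of $f_t$, then $\Phi_f(0)<0$, and consequently $I(t)I''(t)-I'(t)^2<0$ for all sufficiently small $t>0$. In particular, Fisher information along the heat flow is not log-convex in dimension two.
   Context: The heat semigroup on $\mathbb R^d$ is $P_t=e^{t\Delta/2}$, so $f_t=P_tf$ solves $\partial_tf_t=\tfrac12\Delta f_t$ (equivalently $f_t$ is the density of $X+\sqrt t Z$ with $X\sim f$ and $Z$ an independent standard Gaussian). The Fisher information is $I(t)=\int_{\mathbb R^d}|\nabla f_t|^2/f_t\,dx$. For a smooth positive probability density $f=e^u$ on $\mathbb R^d$ with sufficient decay, set $\mathsf H_f=-\nabla^2u$ (the negative Hessian of $\log f$) and \[ \mathcal I[f]=\int\operatorname{tr}(\mathsf H_f)f\,dx,\quad \mathcal Q[f]=\int\operatorname{tr}(\mathsf H_f^2)f\,dx,\quad \mathcal D[f]=\int\big(|\nabla\mathsf H_f|^2+2\operatorname{tr}(\mathsf H_f^3)\big)f\,dx, \] where $|\nabla\mathsf H_f|^2=\sum_{i,j,k}(\partial_k(\mathsf H_f)_{ij})^2$. *)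

(* Defs.v *)
From HB Require Import structures.
From mathcomp Require Import all_boot all_order all_algebra.
From mathcomp Require Import all_classical all_reals all_analysis.
Set Implicit Arguments. Unset Strict Implicit. Unset Printing Implicit Defensive.
Import Order.TTheory GRing.Theory Num.Theory.
Import numFieldNormedType.Exports.
Local Open Scope classical_set_scope.
Local Open Scope ring_scope.

Section Defs.
Variable R : realType.

Definition fun2 := R -> R -> R.

Definition partial1 (g : fun2) : fun2 := fun x y => derive1 (fun x' => g x' y) x.
Definition partial2 (g : fun2) : fun2 := fun x y => derive1 (fun y' => g x y') y.
Definition pd (i : 'I_2) (g : fun2) : fun2 :=
  if i == ord0 then partial1 g else partial2 g.

Fixpoint dpart (l : seq 'I_2) (g : fun2) : fun2 :=
  match l with [::] => g | i :: l' => pd i (dpart l' g) end.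

Definition smooth2 (g : fun2) : Prop :=
  forall (l : seq 'I_2) (x y : R),
    derivable (fun x' => dpart l g x' y) x 1 /\
    derivable (fun y' => dpart l g x y') y 1 /\
    {for (x, y), continuous (fun p : R * R => dpart l g p.1 p.2)}.

Definition leb2 := (@lebesgue_measure R \x @lebesgue_measure R)%E.

Definition integrable2 (g : fun2) : Prop :=
  leb2.-integrable setT (fun p : R * R => (g p.1 p.2)%:E).

Definition int2 (g : fun2) : R :=
  fine (\int[leb2]_(p in setT) (g p.1 p.2)%:E)%E.

Definition Hf (f : fun2) (i j : 'I_2) : fun2 :=
  fun x y => - pd i (pd j (fun a b => ln (f a b))) x y.

Definition trH (f : fun2) : fun2 := fun x y => \sum_(i < 2) Hf f i i x y.
Definition trH2 (f : fun2) : fun2 :=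
  fun x y => \sum_(i < 2) \sum_(j < 2) Hf f i j x y * Hf f j i x y.
Definition trH3 (f : fun2) : fun2 :=
  fun x y => \sum_(i < 2) \sum_(j < 2) \sum_(k < 2)
                Hf f i j x y * Hf f j k x y * Hf f k i x y.
Definition gradH2 (f : fun2) : fun2 :=
  fun x y => \sum_(i < 2) \sum_(j < 2) \sum_(k < 2) (pd k (Hf f i j) x y) ^+ 2.

Definition calI_integrand (f : fun2) : fun2 := fun x y => trH f x y * f x y.
Definition calQ_integrand (f : fun2) : fun2 := fun x y => trH2 f x y * f x y.
Definition calD_integrand (f : fun2) : fun2 :=
  fun x y => (gradH2 f x y + 2 * trH3 f x y) * f x y.

Definition calI (f : fun2) : R := int2 (calI_integrand f).
Definition calQ (f : fun2) : R := int2 (calQ_integrand f).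
Definition calD (f : fun2) : R := int2 (calD_integrand f).

(* heat kernel of e^{t Delta/2} on R^2 (variance t per coordinate) *)
Definition gauss2 (t : R) : fun2 :=
  fun a b => (2 * pi * t)^-1 * expR (- (a ^+ 2 + b ^+ 2) / (2 * t)).

Definition heat (f : fun2) (t : R) : fun2 :=
  fun x y => if 0 < t then int2 (fun a b => f (x - a) (y - b) * gauss2 t a b)
             else f x y.

Definition fisher_integrand (g : fun2) : fun2 :=
  fun x y => ((partial1 g x y) ^+ 2 + (partial2 g x y) ^+ 2) / g x y.
Definition fisher (g : fun2) : R := int2 (fisher_integrand g).

Definition fisherI (f : fun2) (t : R) : R := fisher (heat f t).

End Defs.

(* Main.v *)
Require Import Defs.
From HB Require Import structures.
From mathcomp Require Import all_boot all_order all_algebra.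
From mathcomp Require Import all_classical all_reals all_analysis.
From mathcomp Require Import measurable_realfun ring lra.
Set Implicit Arguments. Unset Strict Implicit. Unset Printing Implicit Defensive.
Import Order.TTheory GRing.Theory Num.Theory.
Import numFieldNormedType.Exports.
Local Open Scope classical_set_scope.
Local Open Scope ring_scope.

(* Let phi = cos 2x + 2 cos x cos (sqrt 3 y), the sum of the three plane waves
   whose wave vectors have length 2 and add up to 0, so that laplacian phi =
   - 4 phi.  If the plane were a torus, f = 1 + eps phi would evolve into
   1 + eps e^(-2t) phi, whose Fisher information is a s^2 - b s^3 + O(s^4) with
   s = eps e^(-2t), a = 4 <phi^2> = 6 and b = 2 <phi^3> = 3 > 0.  The cubic term
   makes log I concave in t: I I'' - I'^2 = - 4 a b s^5 + O(s^6) < 0.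

   On the plane we multiply by a wide Gaussian of variance L = eps^(-8).  The heat
   flow of this density stays explicit, and averages of trigonometric polynomials
   against the Gaussian equal their means up to O(L^(-1/2)), since the
   non-constant part is a divergence.  Bochner's identity gives I' = - Q and
   Q' = - D, so that the two inequalities of the theorem are the same. *)

(** * Gaussian-dominated integrals over the plane *)

Section PlaneIntegral.
Context {R : realType}.
Implicit Types (F G : fun2 R).

(** The logarithm of the density is differentiated three times in space and the functionals in time,
    under integrals over the plane. To justify this once, every integrand is a Gaussian [gsq] times
    an expression in nine atoms closed under the derivations in [t], [x], [y]. Regularity,
    integrability, integration by parts and differentiation under the integral then hold for all
    expressions, and Bochner's identities become polynomial identities. The explicit density makes
    sense for all [t > -1], so [t = 0] is an interior time.

    The quantitative obstacle is a degenerate main term. Up to a common factor and errors, I, Q and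
    D are [6 s^2 - 3 s^3], [24 s^2 - 18 s^3] and [96 s^2 - 108 s^3], each time derivative
    multiplying the coefficients by [- 4] and [- 6]. The order [s^4] of [I D - Q^2] cancels, since a
    single exponential is log-linear, and the sign rests on [- 72 s^5]. Errors in I, Q, D must
    therefore be small against [s^3], which explains the exponent in [L = eps^(-8)]: it makes
    [L^(-1/2) = eps^4]. *)

Definition uncur F : R * R -> R := fun p => F p.1 p.2.

Definition gsq (c : R) : fun2 R := fun x y => expR (- c * (x ^+ 2 + y ^+ 2)).

Lemma measurable_gsq c : measurable_fun setT (uncur (gsq c)).
Proof.
apply: measurableT_comp => //; apply: measurable_funM => //.
by apply: measurable_funD; apply: measurable_funX.
Qed.

Lemma gsq_ge0 c x y : 0 <= gsq c x y. Proof. exact: expR_ge0. Qed.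

Lemma integral_gauss1 (c : R) : 0 < c ->
  (\int[lebesgue_measure]_x (expR (- c * x ^+ 2))%:E)%E = (Num.sqrt (pi / c))%:E.
Proof.
move=> c0; pose s := (Num.sqrt (2 * c))^-1.
have s0 : 0 < s by rewrite invr_gt0 sqrtr_gt0 mulr_gt0.
have s2 : s ^+ 2 = (2 * c)^-1 by rewrite exprVn sqr_sqrtr// mulr_ge0// ltW.
have pk : normal_peak s = (Num.sqrt (pi / c))^-1.
  rewrite /normal_peak; congr (Num.sqrt _)^-1.
  by rewrite s2 mulr2n; field; rewrite gt_eqF.
have nE x : normal_pdf 0 s x = (Num.sqrt (pi / c))^-1 * expR (- c * x ^+ 2).
  rewrite normal_pdfE ?gt_eqF//= -pk; congr (_ * expR _).
  by rewrite s2 subr0 mulr2n; field; rewrite gt_eqF.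
have q0 : Num.sqrt (pi / c) != 0 by rewrite gt_eqF// sqrtr_gt0 divr_gt0// pi_gt0.
have E x : (expR (- c * x ^+ 2))%:E =
    ((Num.sqrt (pi / c))%:E * (normal_pdf 0 s x)%:E)%E.
  by rewrite -EFinM nE mulVKf.
under eq_integral do rewrite E.
rewrite integralZl//; last exact: integrable_normal_pdf.
by rewrite integral_normal_pdf mule1.
Qed.

Lemma integral_gsq (c : R) : 0 < c ->
  (\int[@leb2 R]_p (gsq c p.1 p.2)%:E)%E = (pi / c)%:E.
Proof.
move=> c0; rewrite /leb2 fubini_tonelli1; last 2 first.
- by apply/measurable_EFinP; exact: measurable_gsq.
- by move=> p; rewrite lee_fin gsq_ge0.
have I x : fubini_F lebesgue_measure (fun p : R * R => (gsq c p.1 p.2)%:E) x =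
    ((expR (- c * x ^+ 2))%:E * (Num.sqrt (pi / c))%:E)%E.
  rewrite /fubini_F /= -integral_gauss1//.
  transitivity (\int[lebesgue_measure]_y
      ((expR (- c * x ^+ 2))%:E * (expR (- c * y ^+ 2))%:E))%E.
    by apply: eq_integral => y _; rewrite /gsq mulrDr expRD EFinM.
  rewrite ge0_integralZl//.
  by apply/measurable_EFinP; apply: measurableT_comp => //; apply: measurable_funM.
transitivity (\int[lebesgue_measure]_x
    ((expR (- c * x ^+ 2))%:E * (Num.sqrt (pi / c))%:E))%E.
  by apply: eq_integral => x _; exact: I.
rewrite ge0_integralZr//; last first.
  by apply/measurable_EFinP; apply: measurableT_comp => //; apply: measurable_funM.
by rewrite integral_gauss1// -EFinM -expr2 sqr_sqrtr// divr_ge0// ?pi_ge0// ltW.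
Qed.

Lemma integrable_gsq (c : R) : 0 < c -> integrable2 (gsq c).
Proof.
move=> c0; apply/integrableP; split.
  by apply/measurable_EFinP; exact: measurable_gsq.
under eq_integral => p _ do rewrite gee0_abs ?lee_fin ?gsq_ge0//.
by rewrite integral_gsq// ltry.
Qed.

Definition gdom F := exists C c, 0 < c /\ forall x y, `|F x y| <= C * gsq c x y.

(** Continuity in each variable separately is what the one-variable substitutions behind translation
    invariance consume; the Gaussian bound gives integrability and survives translations. *)
Definition tame F := [/\ measurable_fun setT (uncur F),
  forall y, continuous (F ^~ y), forall x, continuous (F x) & gdom F].

Lemma integrable2Z F k : integrable2 F -> integrable2 (fun x y => k * F x y).
Proof.
move=> iF; rewrite /integrable2.
by under eq_fun do rewrite EFinM; exact: integrableZl.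
Qed.

Lemma integrable2D F G : integrable2 F -> integrable2 G ->
  integrable2 (fun x y => F x y + G x y).
Proof.
move=> iF iG; rewrite /integrable2.
by under eq_fun do rewrite EFinD; exact: integrableD.
Qed.

Lemma gdom_integrable F : measurable_fun setT (uncur F) -> gdom F -> integrable2 F.
Proof.
move=> mF [C [c [c0 FC]]].
have := integrable2Z C (integrable_gsq c0).
apply: le_integrable => //; first exact/measurable_EFinP.
move=> p _; rewrite !abse_EFin lee_fin (le_trans (FC _ _))// ler_norm//.
Qed.

Lemma tame_integrable F : tame F -> integrable2 F.
Proof. by case=> mF _ _; exact: gdom_integrable. Qed.

Lemma int2D F G : integrable2 F -> integrable2 G ->
  int2 (fun x y => F x y + G x y) = int2 F + int2 G.
Proof. by move=> iF iG; rewrite [LHS](RintegralD _ iF iG). Qed.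

Lemma int2Z F k : integrable2 F -> int2 (fun x y => k * F x y) = k * int2 F.
Proof. by move=> iF; rewrite [LHS](RintegralZl _ _ iF). Qed.

Lemma int2N F : integrable2 F -> int2 (fun x y => - F x y) = - int2 F.
Proof.
by move=> iF; rewrite -mulN1r -int2Z//; congr int2; apply/funext => x;
  apply/funext => y; rewrite mulN1r.
Qed.

Lemma le_int2 F G : integrable2 F -> integrable2 G ->
  (forall x y, F x y <= G x y) -> int2 F <= int2 G.
Proof. by move=> iF iG FG; apply: (le_Rintegral _ iF iG) => // p _; exact: FG. Qed.

Lemma normr_int2_le F G : integrable2 F -> integrable2 G ->
  (forall x y, `|F x y| <= G x y) -> `|int2 F| <= int2 G.
Proof.
move=> iF iG FG; rewrite ler_norml -int2N//; apply/andP; split; apply: le_int2 => //.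
- by rewrite /integrable2; under eq_fun do rewrite EFinN; exact: integrableN.
- by move=> x y; have := FG x y; rewrite ler_norml => /andP[].
- by move=> x y; have := FG x y; rewrite ler_norml => /andP[].
Qed.

Lemma int2_gsq c : 0 < c -> int2 (gsq c) = pi / c.
Proof. by move=> c0; rewrite /int2 integral_gsq. Qed.

Lemma integral_shift (G : R -> R) (a : R) : continuous G -> (forall x, 0 <= G x) ->
  (\int[lebesgue_measure]_x (G (x + a))%:E = \int[lebesgue_measure]_x (G x)%:E)%E.
Proof.
move=> cG G0.
have dF (x : R) : is_derive x 1 (fun x : R => x + a) (1 : R).
  by apply: is_derive_eq; rewrite addr0.
have d1 : derive1 (fun x : R => x + a) = cst 1.
  by apply/funext => x; rewrite derive1E derive_val.
rewrite (@increasing_ge0_integration_by_substitutionT _ (fun x => x + a) G)//.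
- by rewrite d1; apply: eq_integral => x _; rewrite /= mulr1.
- by move=> x y xy; rewrite ltrD2r.
- by rewrite d1 => x; exact: cst_continuous.
- by rewrite d1; apply: is_cvg_cst.
- by rewrite d1; apply: is_cvg_cst.
- by apply/cvgrNyPle => A; near=> x; rewrite -lerBrDr; near: x; apply: nbhs_ninfty_le; rewrite num_real.
- by apply/cvgryPge => A; near=> x; rewrite -lerBlDr; near: x; apply: nbhs_pinfty_ge; rewrite num_real.
Unshelve. all: by end_near. Qed.

Lemma measurable_shift2 F a b : measurable_fun setT (uncur F) ->
  measurable_fun setT (uncur (fun x y => F (x + a) (y + b))).
Proof.
move=> mF; rewrite (_ : uncur _ = uncur F \o (fun p => (p.1 + a, p.2 + b)))//.
apply: measurableT_comp => //; apply/measurable_fun_pairP; split => //=.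
- exact: measurable_funD.
- exact: measurable_funD.
Qed.

(** [(x + a)^2 - x^2 / 2 + a^2 = (x + 2 a)^2 / 2]: half of the decay rate pays for the shift, with a
    constant locally bounded in [(a, b)]. *)
Lemma gsq_shift c a b x y : 0 < c ->
  gsq c (x + a) (y + b) <= expR (c * (a ^+ 2 + b ^+ 2)) * gsq (c / 2) x y.
Proof.
move=> c0; rewrite /gsq -expRD ler_expR.
have := sqr_ge0 (x + 2 * a); have := sqr_ge0 (y + 2 * b); nra.
Qed.

Lemma continuous_shift1 (g : R -> R) a : continuous g -> continuous (fun x => g (x + a)).
Proof.
move=> cg x; apply: (continuous_comp (f := fun x => x + a) (g := g)); last exact: cg.
by apply: cvgD; [exact: cvg_id|exact: cvg_cst].
Qed.

Lemma tame_shift F a b : tame F -> tame (fun x y => F (x + a) (y + b)).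
Proof.
case=> mF c1 c2 [C [c [c0 FC]]]; split.
- exact: measurable_shift2.
- by move=> y; apply: (continuous_shift1 (g := F ^~ (y + b))).
- by move=> x; apply: (continuous_shift1 (g := F (x + a))).
exists (C * expR (c * (a ^+ 2 + b ^+ 2))), (c / 2); split; first by rewrite divr_gt0.
move=> x y; rewrite (le_trans (FC _ _))// -mulrA ler_wpM2l ?gsq_shift//.
have := le_trans (normr_ge0 _) (FC 0 0).
by rewrite pmulr_lge0// expR_gt0.
Qed.

Lemma int2_shift_ge0 F a b : tame F -> (forall x y, 0 <= F x y) ->
  int2 (fun x y => F (x + a) (y + b)) = int2 F.
Proof.
move=> tF F0; have [mF c1 c2 _] := tF; rewrite /int2 /leb2; congr fine.
have mFa : measurable_fun setT (uncur (fun x y => F (x + a) y)).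
  by have := measurable_shift2 a 0 mF; rewrite /uncur; under eq_fun do rewrite addr0.
transitivity (\int[lebesgue_measure \x lebesgue_measure]_p (F (p.1 + a) p.2)%:E)%E.
  rewrite fubini_tonelli1; last 2 first.
  - by apply/measurable_EFinP; exact: (measurable_shift2 (F := F) a b).
  - by move=> p; rewrite lee_fin.
  rewrite fubini_tonelli1; last 2 first.
  - exact/measurable_EFinP.
  - by move=> p; rewrite lee_fin.
  by apply: eq_integral => x _; rewrite /fubini_F (integral_shift (G := F (x + a))).
rewrite fubini_tonelli2; last 2 first.
- exact/measurable_EFinP.
- by move=> p; rewrite lee_fin.
rewrite fubini_tonelli2; last 2 first.
- exact/measurable_EFinP.
- by move=> p; rewrite lee_fin.
by apply: eq_integral => y _; rewrite /fubini_G (integral_shift (G := F ^~ y)).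
Qed.

Lemma continuous_gsq1 c y : continuous (gsq c ^~ y).
Proof.
move=> x; apply: (continuous_comp (f := fun x => _) (g := expR)); last exact: continuous_expR.
apply: cvgM; first exact: cvg_cst.
by apply: cvgD; [exact: exprn_continuous|exact: cvg_cst].
Qed.

Lemma gsqC c x y : gsq c x y = gsq c y x.
Proof. by rewrite /gsq addrC. Qed.

Lemma tameZ F k : tame F -> tame (fun x y => k * F x y).
Proof.
case=> mF c1 c2 [C [c [c0 FC]]]; split.
- exact: measurable_funM.
- by move=> y x; apply: cvgM; [exact: cvg_cst|exact: c1].
- by move=> x y; apply: cvgM; [exact: cvg_cst|exact: c2].
by exists (`|k| * C), c; split => // x y; rewrite normrM -mulrA ler_wpM2l.
Qed.

Lemma gdomD F G : gdom F -> gdom G -> gdom (fun x y => F x y + G x y).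
Proof.
move=> [C [c [c0 FC]]] [D [d [d0 GD]]].
have C0 : 0 <= C by have := le_trans (normr_ge0 _) (FC 0 0); rewrite pmulr_lge0// expR_gt0.
have D0 : 0 <= D by have := le_trans (normr_ge0 _) (GD 0 0); rewrite pmulr_lge0// expR_gt0.
exists (C + D), (Num.min c d); split; first by rewrite lt_min c0.
move=> x y; rewrite (le_trans (ler_normD _ _))// mulrDl lerD//.
- apply: (le_trans (FC _ _)); rewrite ler_wpM2l// ler_expR ler_wpM2r ?addr_ge0 ?sqr_ge0//.
  by rewrite lerN2 ge_min lexx.
- apply: (le_trans (GD _ _)); rewrite ler_wpM2l// ler_expR ler_wpM2r ?addr_ge0 ?sqr_ge0//.
  by rewrite lerN2 ge_min lexx orbT.
Qed.

Lemma tameD F G : tame F -> tame G -> tame (fun x y => F x y + G x y).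
Proof.
case=> mF c1 c2 bF [mG d1 d2 bG]; split.
- exact: measurable_funD.
- by move=> y x; apply: cvgD; [exact: c1|exact: d1].
- by move=> x y; apply: cvgD; [exact: c2|exact: d2].
- exact: gdomD.
Qed.

Lemma tame_gsq c : 0 < c -> tame (gsq c).
Proof.
move=> c0; split; first exact: measurable_gsq.
- exact: continuous_gsq1.
- by move=> x; rewrite (_ : gsq c x = gsq c ^~ x) ?continuous_gsq1//; [exact: continuous_gsq1|apply/funext => y; rewrite gsqC].
- by exists 1, c; split => // x y; rewrite mul1r ger0_norm// gsq_ge0.
Qed.

(** Tonelli's theorem needs a nonnegative integrand. Adding the dominating Gaussian [B] makes [F]
    nonnegative, and the integral of [B] is then subtracted. *)
Lemma int2_shift F a b : tame F -> int2 (fun x y => F (x + a) (y + b)) = int2 F.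
Proof.
move=> tF; have [_ _ _ [C [c [c0 FC]]]] := tF.
have C0 : 0 <= C by have := le_trans (normr_ge0 _) (FC 0 0); rewrite pmulr_lge0// expR_gt0.
pose B := fun x y => C * gsq c x y.
have tB : tame B by apply/tameZ/tame_gsq.
have tFB : tame (fun x y => F x y + B x y) by exact: tameD.
have B0 x y : 0 <= B x y by rewrite mulr_ge0// gsq_ge0.
have := int2_shift_ge0 a b tB B0 => BB.
have FB0 x y : 0 <= F x y + B x y.
  by have := FC x y; rewrite ler_norml => /andP[h _]; rewrite -lerBlDr sub0r.
have FB := int2_shift_ge0 a b tFB FB0.
rewrite int2D in FB; [|exact/tame_integrable/tame_shift..].
rewrite int2D in FB; [|exact/tame_integrable..].
by move: FB; rewrite BB => /addIr.
Qed.

Lemma is_derive_int2 (F dF : R -> fun2 R) (u v a : R) C c :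
  u < a < v -> 0 < c ->
  (forall t, u < t < v -> integrable2 (F t)) ->
  (forall t x y, u < t < v -> is_derive t 1 (fun s => F s x y) (dF t x y)) ->
  (forall t x y, u < t < v -> `|dF t x y| <= C * gsq c x y) ->
  is_derive a 1 (fun t => int2 (F t)) (int2 (dF a)).
Proof.
move=> uav c0 iF der dom.
have Ia : `]u, v[%classic a by rewrite /= in_itv.
have dE t p : `]u, v[%classic t ->
    partial1of2 (fun t (p : R * R) => F t p.1 p.2) t p = dF t p.1 p.2.
  rewrite /= in_itv /= => It; rewrite partial1of2E.
  by have [_] := der t p.1 p.2 It; apply.
have C0 : 0 <= C by have := le_trans (normr_ge0 _) (dom a 0 0 uav); rewrite pmulr_lge0// expR_gt0.
have h1 t : `]u, v[%classic t ->
    (@leb2 R).-integrable setT (EFin \o (fun p : R * R => F t p.1 p.2)).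
  by rewrite /= in_itv /= => It; exact: iF.
have h2 t (p : R * R) : `]u, v[%classic t -> setT p ->
    derivable (fun t => F t p.1 p.2) t 1.
  by rewrite /= in_itv /= => It _; have [] := der t p.1 p.2 It.
have h3 (p : R * R) : 0 <= C * gsq c p.1 p.2 by rewrite mulr_ge0// gsq_ge0.
have h4 : (@leb2 R).-integrable setT (EFin \o (fun p : R * R => C * gsq c p.1 p.2)).
  by apply: (integrable2Z C); exact: integrable_gsq.
have h5 t (p : R * R) : `]u, v[%classic t -> setT p ->
    `|partial1of2 (fun t (p : R * R) => F t p.1 p.2) t p| <= C * gsq c p.1 p.2.
  by move=> It _; rewrite dE//; move: It; rewrite /= in_itv /= => It; exact: dom.
apply: DeriveDef.
  by apply: (derivable_under_integral (mu := @leb2 R) measurableT Ia h1 h2 h3 h4 h5).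
rewrite -derive1E [LHS](differentiation_under_integral (mu := @leb2 R) measurableT Ia h1 h2 h3 h4 h5).
by apply: eq_Rintegral => p _; rewrite dE.
Qed.

(* The integral of F (. + s (a, b)) does not depend on s; dF is the integrand of its
   derivative at s = 0. *)
Lemma int2_directional (F dF : fun2 R) (a b : R) : tame F -> tame dF ->
  (forall t x y : R, is_derive t 1 (fun s => F (x + s * a) (y + s * b))
                       (dF (x + t * a) (y + t * b))) -> int2 dF = 0.
Proof.
move=> tF [mdF c1 c2 [C [c [c0 dFC]]]] der.
have C0 : 0 <= C by have := le_trans (normr_ge0 _) (dFC 0 0); rewrite pmulr_lge0// expR_gt0.
have D : is_derive (0 : R) 1 (fun t => int2 (fun x y => F (x + t * a) (y + t * b)))
    (int2 (fun x y => dF (x + 0 * a) (y + 0 * b))).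
  apply: (@is_derive_int2 (fun t x y => F (x + t * a) (y + t * b))
    (fun t x y => dF (x + t * a) (y + t * b))
    (-1) 1 0 (C * expR (c * (a ^+ 2 + b ^+ 2))) (c / 2)).
  - by rewrite ltrN10 ltr01.
  - by rewrite divr_gt0.
  - by move=> t _; apply: tame_integrable; exact: tame_shift.
  - move=> t x y /andP[t1 t2]; rewrite (le_trans (dFC _ _))// -mulrA ler_wpM2l//.
    rewrite (le_trans (gsq_shift _ _ _ _ c0))// ler_wpM2r ?gsq_ge0// ler_expR.
    rewrite ler_wpM2l ?(ltW c0)// !exprMn.
    have tt : t ^+ 2 <= 1 by nra.
    by rewrite lerD// ler_piMl ?sqr_ge0.
have {}D : is_derive (0 : R) 1 (fun=> int2 F) (int2 dF).
  have E1 : (fun x y => dF (x + 0 * a) (y + 0 * b)) = dF.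
    by apply/funext => x; apply/funext => y; rewrite !mul0r !addr0.
  have E2 : (fun t => int2 (fun x y => F (x + t * a) (y + t * b))) = (fun=> int2 F).
    by apply/funext => t; exact: int2_shift.
  by rewrite E1 E2 in D.
have [_ <-] := D; exact: derive_cst.
Qed.

Lemma is_derive_addl (z t : R) : is_derive t 1 (fun s : R => z + s) (1 : R).
Proof. by have := @is_deriveD _ _ _ (cst z) id t 1 0 1 _ _; rewrite add0r; apply. Qed.

Lemma int2_dx (F dF : fun2 R) : tame F -> tame dF ->
  (forall x y : R, is_derive x 1 (F ^~ y) (dF x y)) -> int2 dF = 0.
Proof.
move=> tF tdF der; apply: (int2_directional (a := 1) (b := 0) tF tdF) => t x y.
under eq_fun do rewrite mulr1 mulr0 addr0.
rewrite mulr1 mulr0 addr0 -[dF _ _]mulr1.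
exact: (@is_derive1_comp _ (F ^~ y) (fun s => x + s) t _ _ (der _ _) (is_derive_addl x t)).
Qed.

Lemma int2_dy (F dF : fun2 R) : tame F -> tame dF ->
  (forall x y : R, is_derive y 1 (F x) (dF x y)) -> int2 dF = 0.
Proof.
move=> tF tdF der; apply: (int2_directional (a := 0) (b := 1) tF tdF) => t x y.
under eq_fun do rewrite mulr1 mulr0 addr0.
rewrite mulr1 mulr0 addr0 -[dF _ _]mulr1.
exact: (@is_derive1_comp _ (F x) (fun s => y + s) t _ _ (der _ _) (is_derive_addl y t)).
Qed.

End PlaneIntegral.

(** * Functions growing slower than every Gaussian *)

Section Growth.
Context {R : realType}.
Implicit Types (F G : fun2 R).

(** Joint continuity is what [smooth2] asks of the density, and its slices give the continuity
    required by [tame]. *)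
Definition reg F := measurable_fun setT (uncur F) /\ continuous (uncur F).

Lemma regD F G : reg F -> reg G -> reg (fun x y => F x y + G x y).
Proof.
move=> [mF cF] [mG cG]; split; first exact: measurable_funD.
by move=> p; apply: cvgD; [exact: cF|exact: cG].
Qed.

Lemma regM F G : reg F -> reg G -> reg (fun x y => F x y * G x y).
Proof.
move=> [mF cF] [mG cG]; split; first exact: measurable_funM.
by move=> p; apply: cvgM; [exact: cF|exact: cG].
Qed.

Lemma reg_cst (k : R) : reg (fun _ _ => k).
Proof. by split; [exact: measurable_cst|move=> p; exact: cvg_cst]. Qed.

Lemma reg_x : reg (fun x _ => x).
Proof. by split; [exact: measurable_fst|move=> p; exact: cvg_fst]. Qed.

Lemma reg_y : reg (fun _ y => y).
Proof. by split; [exact: measurable_snd|move=> p; exact: cvg_snd]. Qed.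

Lemma reg_comp (g : R -> R) F : continuous g -> reg F -> reg (fun x y => g (F x y)).
Proof.
move=> cg [mF cF]; split.
  by apply: measurableT_comp => //; exact: continuous_measurable_fun.
by move=> p; apply: continuous_comp; [exact: cF|exact: cg].
Qed.

Lemma reg_gsq c : reg (gsq c).
Proof.
rewrite /gsq; apply: (reg_comp (g := expR)); first exact: continuous_expR.
apply: regM; first exact: reg_cst.
by apply: regD; apply: (reg_comp (g := fun x => x ^+ 2)); [exact: exprn_continuous|exact: reg_x|exact: exprn_continuous|exact: reg_y].
Qed.

Lemma reg_slice1 F y : reg F -> continuous (F ^~ y).
Proof.
move=> [_ cF] x; apply: (continuous_comp (f := fun x => (x, y)) (g := uncur F)).
  by apply: (@cvg_pair _ _ _ (nbhs x) (nbhs x) (nbhs y) _ _ _ id (cst y)); [exact: cvg_id|exact: cvg_cst].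
exact: cF.
Qed.

Lemma reg_slice2 F x : reg F -> continuous (F x).
Proof.
move=> [_ cF] y; apply: (continuous_comp (f := fun y => (x, y)) (g := uncur F)).
  by apply: (@cvg_pair _ _ _ (nbhs y) (nbhs x) (nbhs y) _ _ _ (cst x) id); [exact: cvg_cst|exact: cvg_id].
exact: cF.
Qed.

(* Growth slower than every Gaussian, uniformly for the parameter in U. *)
Definition subgauss (T : Type) (U : set T) (F : T -> fun2 R) :=
  forall e : R, 0 < e -> exists C, 0 <= C /\
    forall t x y, U t -> `|F t x y| <= C * gsq (- e) x y.

Section Subgauss.
Variables (T : Type) (U : set T).
Implicit Types H K : T -> fun2 R.

Lemma subgaussD H K : subgauss U H -> subgauss U K ->
  subgauss U (fun t x y => H t x y + K t x y).
Proof.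
move=> hH hK e e0; have [C [C0 hC]] := hH e e0; have [D [D0 hD]] := hK e e0.
exists (C + D); split; first exact: addr_ge0.
move=> t x y Ut; rewrite mulrDl (le_trans (ler_normD _ _))// lerD//.
- exact: hC.
- exact: hD.
Qed.

Lemma subgaussM H K : subgauss U H -> subgauss U K ->
  subgauss U (fun t x y => H t x y * K t x y).
Proof.
move=> hH hK e e0; have e2 : 0 < e / 2 by rewrite divr_gt0.
have [C [C0 hC]] := hH _ e2; have [D [D0 hD]] := hK _ e2.
exists (C * D); split; first exact: mulr_ge0.
move=> t x y Ut.
have -> : gsq (- e) x y = gsq (- (e / 2)) x y * gsq (- (e / 2)) x y.
  by rewrite /gsq -expRD; congr expR; field.
by rewrite normrM mulrACA ler_pM//; [exact: hC|exact: hD].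
Qed.

Lemma subgauss_bounded H k : (forall t x y, U t -> `|H t x y| <= k) -> subgauss U H.
Proof.
move=> Hk e e0; exists (`|k|); split => // t x y Ut.
rewrite (le_trans (Hk _ _ _ Ut))// (le_trans (ler_norm k))// ler_peMr//.
by rewrite -expR0 ler_expR opprK mulr_ge0 ?addr_ge0 ?sqr_ge0// ltW.
Qed.

Lemma norm_le_gsq (e x y : R) : 0 < e -> `|x| <= (1 + e^-1) * gsq (- e) x y.
Proof.
move=> e0; apply: (@le_trans _ _ ((1 + e^-1) * (1 + e * (x ^+ 2 + y ^+ 2)))).
  have -> : (1 + e^-1) * (1 + e * (x ^+ 2 + y ^+ 2)) =
      1 + e^-1 + e * (x ^+ 2 + y ^+ 2) + (x ^+ 2 + y ^+ 2).
    by field; rewrite gt_eqF.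
  have ei : 0 < e^-1 by rewrite invr_gt0.
  have ey : 0 <= e * (x ^+ 2 + y ^+ 2) by rewrite mulr_ge0 ?addr_ge0 ?sqr_ge0// ltW.
  have h : `|x| ^+ 2 = x ^+ 2 by exact: real_normK (num_real x).
  by have := sqr_ge0 y; have := sqr_ge0 (`|x| - 1); have := sqr_ge0 x; nra.
have e1 : 0 <= 1 + e^-1 by rewrite addr_ge0// invr_ge0 ltW.
rewrite ler_wpM2l//.
by rewrite /gsq opprK expR_ge1Dx.
Qed.

Lemma subgauss_x : subgauss U (fun _ x _ => x).
Proof.
move=> e e0; exists (1 + e^-1); split; first by rewrite addr_ge0// invr_ge0 ltW.
by move=> t x y _; exact: norm_le_gsq.
Qed.

Lemma subgauss_y : subgauss U (fun _ _ y => y).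
Proof.
move=> e e0; exists (1 + e^-1); split; first by rewrite addr_ge0// invr_ge0 ltW.
by move=> t x y _; rewrite gsqC; exact: norm_le_gsq.
Qed.

(* Half of the Gaussian decay absorbs the growth, uniformly in the parameter. *)
Lemma subgauss_gsq H (c : R) : subgauss U H -> 0 < c -> exists C,
  forall t x y, U t -> `|gsq c x y * H t x y| <= C * gsq (c / 2) x y.
Proof.
move=> hH c0; have c2 : 0 < c / 2 by rewrite divr_gt0.
have [C [C0 hC]] := hH _ c2; exists C => t x y Ut.
rewrite normrM (ger0_norm (gsq_ge0 _ _ _)).
rewrite (le_trans (ler_wpM2l (gsq_ge0 _ _ _) (hC t x y Ut)))// mulrCA.
by rewrite ler_wpM2l// /gsq -expRD ler_expR; lra.
Qed.

End Subgauss.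

Lemma tame_subgauss F c : 0 < c -> reg F -> subgauss [set: unit] (fun=> F) ->
  tame (fun x y => gsq c x y * F x y).
Proof.
move=> c0 rF sF; have r := regM (reg_gsq c) rF; split.
- by case: r.
- by move=> y; exact: (reg_slice1 (F := fun x y => gsq c x y * F x y)).
- by move=> x; exact: (reg_slice2 (F := fun x y => gsq c x y * F x y)).
have [C hC] := subgauss_gsq sF c0.
exists C, (c / 2); split; first by rewrite divr_gt0.
by move=> x y; exact: (hC tt).
Qed.

End Growth.

(** * Fourier transform of the Gaussian and heat evolution of a plane wave *)

Section GaussianFourier.
Context {R : realType}.
Implicit Types (s k l th : R).

Lemma gauss2E s : 0 < s -> gauss2 s = fun x y => (2 * pi * s)^-1 * gsq (2 * s)^-1 x y.
Proof.
move=> s0; apply/funext => x; apply/funext => y; rewrite /gauss2 /gsq.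
by congr (_ * expR _); field; rewrite gt_eqF.
Qed.

Lemma is_derive_gsq1 c (x y : R) :
  is_derive x 1 (gsq c ^~ y) (- (2 * c * x) * gsq c x y).
Proof.
rewrite /gsq; apply: (is_derive_eq (is_derive1_comp _ _)).
by rewrite /GRing.scale /=; ring.
Qed.

Lemma is_derive_gsq2 c (x y : R) :
  is_derive y 1 (gsq c x) (- (2 * c * y) * gsq c x y).
Proof.
have -> : gsq c x = gsq c ^~ x by apply/funext => z; rewrite gsqC.
exact: is_derive_gsq1.
Qed.

(** The phase carries a minus sign because a convolution evaluates the wave at [(x - a, y - b)];
    [th] absorbs the part that depends on [(x, y)]. *)
Definition wave k l th : fun2 R := fun a b => cos (th - (k * a + l * b)).
Definition swave k l th : fun2 R := fun a b => sin (th - (k * a + l * b)).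

Lemma reg_phase k l th : reg (fun a b : R => th - (k * a + l * b)).
Proof.
apply: regD; first exact: reg_cst.
apply: (reg_comp (g := -%R)); first by move=> x; exact: oppr_continuous.
by apply: regD; apply: regM; [exact: reg_cst|exact: reg_x|exact: reg_cst|exact: reg_y].
Qed.

Lemma reg_wave k l th : reg (wave k l th).
Proof. by apply: (reg_comp (g := cos)); [exact: continuous_cos|exact: reg_phase]. Qed.

Lemma reg_swave k l th : reg (swave k l th).
Proof. by apply: (reg_comp (g := sin)); [exact: continuous_sin|exact: reg_phase]. Qed.

Lemma norm_cos (x : R) : `|cos x| <= 1.
Proof. by rewrite ler_norml cos_geN1 cos_le1. Qed.

Lemma norm_sin (x : R) : `|sin x| <= 1.
Proof. by rewrite ler_norml sin_geN1 sin_le1. Qed.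

Lemma is_derive_swave1 k l th (a b : R) :
  is_derive a 1 (swave k l th ^~ b) (- k * wave k l th a b).
Proof.
rewrite /swave /wave; apply: (is_derive_eq (is_derive1_comp _ _)).
by rewrite /GRing.scale /=; ring.
Qed.

Lemma is_derive_swave2 k l th (a b : R) :
  is_derive b 1 (swave k l th a) (- l * wave k l th a b).
Proof.
rewrite /swave /wave; apply: (is_derive_eq (is_derive1_comp _ _)).
by rewrite /GRing.scale /=; ring.
Qed.

Lemma is_derive_waveT k l th (a b t : R) :
  is_derive t 1 (fun t => wave (t * k) (t * l) th a b)
    ((k * a + l * b) * swave (t * k) (t * l) th a b).
Proof.
rewrite /swave /wave; apply: (is_derive_eq (is_derive1_comp _ _)).
by rewrite /GRing.scale /=; ring.
Qed.

Lemma subgauss_wave k l th : subgauss [set: unit] (fun=> wave k l th).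
Proof. by apply: (@subgauss_bounded _ _ _ _ 1) => t x y _; exact: norm_cos. Qed.

Lemma subgauss_swave k l th : subgauss [set: unit] (fun=> swave k l th).
Proof. by apply: (@subgauss_bounded _ _ _ _ 1) => t x y _; exact: norm_sin. Qed.

Lemma tame_wave c k l th : 0 < c -> tame (fun a b => gsq c a b * wave k l th a b).
Proof. by move=> c0; apply: tame_subgauss => //; [exact: reg_wave|exact: subgauss_wave]. Qed.

Lemma tame_swave c k l th : 0 < c -> tame (fun a b => gsq c a b * swave k l th a b).
Proof. by move=> c0; apply: tame_subgauss => //; [exact: reg_swave|exact: subgauss_swave]. Qed.

Lemma tame_xswave c k l th : 0 < c -> tame (fun a b => gsq c a b * (a * swave k l th a b)).
Proof.
move=> c0; apply: tame_subgauss => //.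
- by apply: regM; [exact: reg_x|exact: reg_swave].
- by apply: subgaussM; [exact: subgauss_x|exact: subgauss_swave].
Qed.

Lemma tame_yswave c k l th : 0 < c -> tame (fun a b => gsq c a b * (b * swave k l th a b)).
Proof.
move=> c0; apply: tame_subgauss => //.
- by apply: regM; [exact: reg_y|exact: reg_swave].
- by apply: subgaussM; [exact: subgauss_y|exact: subgauss_swave].
Qed.

(** The [a]-derivative of [gsq c * swave] integrates to zero. *)
Lemma stein1 c k l th : 0 < c ->
  2 * c * int2 (fun a b => gsq c a b * (a * swave k l th a b)) =
  - k * int2 (fun a b => gsq c a b * wave k l th a b).
Proof.
move=> c0; have tx := tame_xswave k l th c0; have tw := tame_wave k l th c0.
have tD := tameD (tameZ (- (2 * c)) tx) (tameZ (- k) tw).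
have := int2_dx (tame_swave k l th c0) tD.
rewrite int2D; [|exact/tame_integrable/tameZ..].
rewrite !int2Z; [|exact/tame_integrable..].
move=> /(_ _)/eqP; rewrite mulNr addrC subr_eq0 => H; apply/esym/eqP/H => x y.
have d1 := is_derive_gsq1 c x y; have d2 := is_derive_swave1 k l th x y.
by apply: (is_derive_eq (is_deriveM _ _)); rewrite /GRing.scale /=; ring.
Qed.

Lemma stein2 c k l th : 0 < c ->
  2 * c * int2 (fun a b => gsq c a b * (b * swave k l th a b)) =
  - l * int2 (fun a b => gsq c a b * wave k l th a b).
Proof.
move=> c0; have tx := tame_yswave k l th c0; have tw := tame_wave k l th c0.
have tD := tameD (tameZ (- (2 * c)) tx) (tameZ (- l) tw).
have := int2_dy (tame_swave k l th c0) tD.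
rewrite int2D; [|exact/tame_integrable/tameZ..].
rewrite !int2Z; [|exact/tame_integrable..].
move=> /(_ _)/eqP; rewrite mulNr addrC subr_eq0 => H; apply/esym/eqP/H => x y.
have d1 := is_derive_gsq2 c x y; have d2 := is_derive_swave2 k l th x y.
by apply: (is_derive_eq (is_deriveM _ _)); rewrite /GRing.scale /=; ring.
Qed.

Lemma is_derive_int2_wave c k l th (t : R) : 0 < c ->
  is_derive t 1 (fun t => int2 (fun a b => gsq c a b * wave (t * k) (t * l) th a b))
    (- ((k ^+ 2 + l ^+ 2) * t / (2 * c)) *
       int2 (fun a b => gsq c a b * wave (t * k) (t * l) th a b)).
Proof.
move=> c0.
pose m : R -> fun2 R := fun t a b => (k * a + l * b) * swave (t * k) (t * l) th a b.
have sm : subgauss [set: R] m.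
  apply: subgaussM.
    by apply: subgaussD; apply: subgaussM; (try exact: subgauss_x); (try exact: subgauss_y);
      apply: (@subgauss_bounded _ _ _ _ _).
  by apply: (@subgauss_bounded _ _ _ _ 1) => s x y _; exact: norm_sin.
have [C hC] := subgauss_gsq sm c0.
have := @is_derive_int2 _ (fun t a b => gsq c a b * wave (t * k) (t * l) th a b)
  (fun t a b => gsq c a b * m t a b) (t - 1) (t + 1) t C (c / 2) _ _ _ _ _.
have -> : int2 (fun a b => gsq c a b * m t a b) = - ((k ^+ 2 + l ^+ 2) * t / (2 * c)) *
       int2 (fun a b => gsq c a b * wave (t * k) (t * l) th a b).
  have -> : (fun a b => gsq c a b * m t a b) = (fun a b =>
      k * (gsq c a b * (a * swave (t * k) (t * l) th a b)) +
      l * (gsq c a b * (b * swave (t * k) (t * l) th a b))).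
    by apply/funext => a; apply/funext => b; rewrite /m; ring.
  have c20 : 2 * c != 0 by rewrite mulf_neq0// gt_eqF.
  rewrite int2D; [|exact/tame_integrable/tameZ/tame_xswave|exact/tame_integrable/tameZ/tame_yswave].
  rewrite !int2Z; [|exact/tame_integrable/tame_yswave|exact/tame_integrable/tame_xswave].
  apply: (mulfI c20); rewrite mulrDr (mulrCA _ k) (mulrCA _ l) stein1// stein2//.
  by field; rewrite gt_eqF.
apply.
- by apply/andP; split; lra.
- by rewrite divr_gt0.
- by move=> s _; exact/tame_integrable/tame_wave.
- move=> s x y _; have d := is_derive_waveT k l th x y s.
  by apply: (is_derive_eq (is_deriveM _ _)); rewrite /GRing.scale /m /=; ring.
- by move=> s x y _; exact: hC.
Qed.

(* By Stein's identity the integral J of the wave t (k, l) satisfies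
   J' t = - 2 K t J t, so exp (K t^2) J t is constant. *)
Lemma int2_gsq_wave c k l th : 0 < c ->
  int2 (fun a b => gsq c a b * wave k l th a b) =
  pi / c * (expR (- ((k ^+ 2 + l ^+ 2) / (4 * c))) * cos th).
Proof.
move=> c0; pose K := (k ^+ 2 + l ^+ 2) / (4 * c).
pose J t := int2 (fun a b => gsq c a b * wave (t * k) (t * l) th a b).
have dJ (t : R) : is_derive t 1 (fun t => expR (K * t ^+ 2) * J t) 0.
  have d1 := is_derive_int2_wave k l th t c0.
  have d2 : is_derive t 1 (fun t : R => K * t ^+ 2) (K * (2 * t)).
    by apply: is_derive_eq; rewrite /GRing.scale /=; ring.
  have d3 := @is_derive1_comp _ expR (fun t : R => K * t ^+ 2) t _ _ (is_derive_expR _) d2.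
  apply: (is_derive_eq (is_deriveM d3 d1)); rewrite /GRing.scale /= /K.
  by rewrite /J; field; rewrite gt_eqF.
have := is_derive_0_is_cst 1 0 dJ.
rewrite expr0n mulr0 expR0 mul1r /J !mul1r !mul0r expr1n mulr1 => E.
have J0 : int2 (fun a b => gsq c a b * wave 0 0 th a b) = pi / c * cos th.
  rewrite -int2_gsq// mulrC -int2Z; last exact: integrable_gsq.
  congr int2; apply/funext => a; apply/funext => b.
  by rewrite /wave !mul0r addr0 subr0 mulrC.
apply: (mulfI (lt0r_neq0 (expR_gt0 K))); rewrite E J0 -/K.
by rewrite mulrCA [expR K * _]mulrA -expRD subrr expR0 mul1r.
Qed.

(** Completing the square: Gaussians of variances [L] and [t] multiply to one of variance [L + t] in
    [(x, y)] times one of variance [t L / (L + t)] in [(a, b)], centred at [t / (L + t) (x, y)].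
    Recentred there, the wave keeps the phase [L / (L + t) (k x + l y)]. *)
Lemma heat_wave_shape (L t k l x y : R) : 0 < L -> 0 < t ->
  (fun a b => gsq (2 * L)^-1 (x - a) (y - b) *
              cos (k * (x - a) + l * (y - b)) * gauss2 t a b) =
  (fun a b => (2 * pi * t)^-1 * gsq (2 * (L + t))^-1 x y *
    (gsq (2 * (t * L / (L + t)))^-1 (a + - (t / (L + t) * x)) (b + - (t / (L + t) * y)) *
     wave k l (k * (L / (L + t) * x) + l * (L / (L + t) * y))
       (a + - (t / (L + t) * x)) (b + - (t / (L + t) * y)))).
Proof.
move=> L0 t0; have Lt0 : 0 < L + t by rewrite addr_gt0.
apply/funext => a; apply/funext => b.
have -> : wave k l (k * (L / (L + t) * x) + l * (L / (L + t) * y))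
    (a + - (t / (L + t) * x)) (b + - (t / (L + t) * y)) =
    cos (k * (x - a) + l * (y - b)).
  by rewrite /wave; congr cos; field; rewrite gt_eqF.
have HG : gsq (2 * L)^-1 (x - a) (y - b) * gsq (2 * t)^-1 a b =
    gsq (2 * (L + t))^-1 x y *
    gsq (2 * (t * L / (L + t)))^-1 (a + - (t / (L + t) * x)) (b + - (t / (L + t) * y)).
  rewrite /gsq -!expRD; congr expR; field.
  by rewrite (gt_eqF Lt0) (gt_eqF t0) (gt_eqF L0).
rewrite gauss2E//; move: (2 * pi * t)^-1 => P.
rewrite [LHS](_ : _ = P * cos (k * (x - a) + l * (y - b)) *
  (gsq (2 * L)^-1 (x - a) (y - b) * gsq (2 * t)^-1 a b)); last by ring.
by rewrite HG; ring.
Qed.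

Lemma integrable_heat_wave (L t k l x y : R) : 0 < L -> 0 < t ->
  integrable2 (fun a b => gsq (2 * L)^-1 (x - a) (y - b) *
              cos (k * (x - a) + l * (y - b)) * gauss2 t a b).
Proof.
move=> L0 t0; have Lt0 : 0 < L + t by rewrite addr_gt0.
rewrite heat_wave_shape//; apply/tame_integrable/tameZ.
apply: (tame_shift (- (t / (L + t) * x)) (- (t / (L + t) * y)) (tame_wave _ _ _ _)).
by rewrite invr_gt0 mulr_gt0// divr_gt0// mulr_gt0.
Qed.

Lemma int2_heat_wave (L t k l x y : R) : 0 < L -> 0 < t ->
  int2 (fun a b => gsq (2 * L)^-1 (x - a) (y - b) *
                   cos (k * (x - a) + l * (y - b)) * gauss2 t a b) =
  L / (L + t) * gsq (2 * (L + t))^-1 x y *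
  (expR (- ((k ^+ 2 + l ^+ 2) * (t * L / (L + t)) / 2)) *
   cos (k * (L / (L + t) * x) + l * (L / (L + t) * y))).
Proof.
move=> L0 t0; have Lt0 : 0 < L + t by rewrite addr_gt0.
rewrite heat_wave_shape//.
pose s := t * L / (L + t); have s0 : 0 < s by rewrite divr_gt0 ?mulr_gt0.
have c0 : 0 < (2 * s)^-1 by rewrite invr_gt0 mulr_gt0.
rewrite -/s int2Z; last first.
  exact/tame_integrable/(tame_shift (- (t / (L + t) * x)) (- (t / (L + t) * y)) (tame_wave k l _ c0)).
rewrite (int2_shift (- (t / (L + t) * x)) (- (t / (L + t) * y)) (tame_wave k l _ c0)).
rewrite int2_gsq_wave//.
have -> : (k ^+ 2 + l ^+ 2) / (4 * (2 * s)^-1) = (k ^+ 2 + l ^+ 2) * s / 2.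
  by field; rewrite gt_eqF.
rewrite mulrACA -[RHS]mulrA; congr (_ * _).
rewrite /s; have := pi_gt0 R; move: (@pi R) => p p0; field.
by rewrite (gt_eqF Lt0) (gt_eqF t0) (gt_eqF L0) (gt_eqF p0).
Qed.

End GaussianFourier.

(** * Symbolic calculus for the perturbed Gaussian *)

(* With r = 1 / (L + t), rho = L r, sigma the amplitude at time t, the atoms stand for
   x, y, r, sigma, cos (rho x), sin (rho x), cos (q rho y), sin (q rho y) and
   1 / (1 + sigma phi (rho x, rho y)), where q = sqrt 3. *)
Inductive atom := AX | AY | AR | AS | AC1 | AS1 | AC2 | AS2 | AW.
Inductive var := VT | VX | VY.

Section Expressions.
Context {R : realType}.

Inductive expr := Cst of R | At of atom | Add of expr & expr | Mul of expr & expr.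

Implicit Types (e : expr) (v w : var) (a : atom).

Fixpoint evr (m : atom -> R) e : R :=
  match e with
  | Cst c => c
  | At a => m a
  | Add e1 e2 => evr m e1 + evr m e2
  | Mul e1 e2 => evr m e1 * evr m e2
  end.

Fixpoint derive_with (d : atom -> expr) e : expr :=
  match e with
  | Cst _ => Cst 0
  | At a => d a
  | Add e1 e2 => Add (derive_with d e1) (derive_with d e2)
  | Mul e1 e2 => Add (Mul (derive_with d e1) e2) (Mul e1 (derive_with d e2))
  end.

Variables (L eps q : R).

Definition Neg e := Mul (Cst (-1)) e.

(** [cos (2 X)] is written [2 cos X ^ 2 - 1], so that four trigonometric atoms suffice. *)
Definition phiE := Add (Add (Mul (Cst 2) (Mul (At AC1) (At AC1))) (Cst (-1)))
                       (Mul (Cst 2) (Mul (At AC1) (At AC2))).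
Definition sphiE := Mul (At AS) phiE.

(** The derivative of [AW] involves that of [sphiE]. Since [AW] does not occur in [sphiE], two
    stages avoid a circular definition: [AW] gets the dummy value [Cst 0] here and its true
    derivative in [datom]. *)
Definition datom0 v a : expr :=
  match v, a with
  | VT, AR => Neg (Mul (At AR) (At AR))
  | VT, AS => Mul (Cst (- 2 * L ^+ 2)) (Mul (Mul (At AR) (At AR)) (At AS))
  | VT, AC1 => Mul (Cst L) (Mul (At AX) (Mul (Mul (At AR) (At AR)) (At AS1)))
  | VT, AS1 => Mul (Cst (- L)) (Mul (At AX) (Mul (Mul (At AR) (At AR)) (At AC1)))
  | VT, AC2 => Mul (Cst (q * L)) (Mul (At AY) (Mul (Mul (At AR) (At AR)) (At AS2)))
  | VT, AS2 => Mul (Cst (- (q * L))) (Mul (At AY) (Mul (Mul (At AR) (At AR)) (At AC2)))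
  | VX, AX => Cst 1
  | VX, AC1 => Mul (Cst (- L)) (Mul (At AR) (At AS1))
  | VX, AS1 => Mul (Cst L) (Mul (At AR) (At AC1))
  | VY, AY => Cst 1
  | VY, AC2 => Mul (Cst (- (q * L))) (Mul (At AR) (At AS2))
  | VY, AS2 => Mul (Cst (q * L)) (Mul (At AR) (At AC2))
  | _, _ => Cst 0
  end.

Definition datom v a : expr :=
  match a with
  | AW => Neg (Mul (Mul (At AW) (At AW)) (derive_with (datom0 v) sphiE))
  | _ => datom0 v a
  end.

Definition deriveE v := derive_with (datom v).

Local Notation D := deriveE.

(* Logarithmic derivatives of the Gaussian factor exp (- r (x^2 + y^2) / 2). *)
Definition logE v : expr :=
  match v with
  | VT => Mul (Cst 2^-1) (Mul (Add (Mul (At AX) (At AX)) (Mul (At AY) (At AY)))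
                              (Mul (At AR) (At AR)))
  | VX => Neg (Mul (At AX) (At AR))
  | VY => Neg (Mul (At AY) (At AR))
  end.

(** For the Gaussian factor [G], the derivative of [G * e] is [G * gderiveE v e]. *)
Definition gderiveE v e := Add (D v e) (Mul (logE v) e).

(* Derivatives of u = log f_t, where f_t = n r exp (- r (x^2 + y^2) / 2) (1 + sigma phi). *)
Definition scoreE v := Add (logE v) (Add (match v with VT => Neg (At AR) | _ => Cst 0 end)
                                         (Mul (At AW) (D v sphiE))).

(** The commutator of two derivations is a derivation, so the atoms decide. For them the identity is
    polynomial and valid for every assignment [m]. *)
Lemma evr_commD m v w e : evr m (D v (D w e)) = evr m (D w (D v e)).
Proof.
elim: e => [c|a|e1 IH1 e2 IH2|e1 IH1 e2 IH2] //=.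
- by case: v; case: w; case: a => /=; ring.
- by rewrite IH1 IH2.
- by rewrite IH1 IH2; ring.
Qed.

Lemma evr_score_sym m v w : evr m (D v (scoreE w)) = evr m (D w (scoreE v)).
Proof. by case: v; case: w => /=; field. Qed.

(** The squares of [AW] cancel between the Laplacian of [u] and its squared gradient. What remains
    is linear in [AW], and the two hypotheses enter through [laplacian phi = - 4 phi]. *)
Lemma evr_score_heat m : q ^+ 2 = 3 -> m AS1 ^+ 2 = 1 - m AC1 ^+ 2 ->
  evr m (scoreE VT) = 2^-1 * (evr m (D VX (scoreE VX)) + evr m (D VY (scoreE VY)) +
    evr m (scoreE VX) ^+ 2 + evr m (scoreE VY) ^+ 2).
Proof.
move=> q2 s2 /=.
by field: q2 s2.
Qed.

End Expressions.

(** * Expressions as functions of time and space, for t > -1 *)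

Section Semantics.
Context {R : realType}.
Variables (L eps q : R).
Hypotheses (L2 : 2 <= L) (eps0 : 0 < eps) (eps1 : eps <= expR (- 4) / 6).
Implicit Types (e : @expr R) (v w : var) (t x y : R).

Local Notation D := (@deriveE R L q).
Local Notation DE := (@gderiveE R L q).
Local Notation sphiE := (@sphiE R).

(* The smallness of eps gives amplitude <= 1/6 for all t > -1, so the density is positive
   on a neighbourhood of t = 0. *)
Definition precision t := (L + t)^-1.
(** [1 - L * precision t = t / (L + t)], so the exponent is [- 2 L t / (L + t)]: the damping of a
    wave of squared length 4 carried by a Gaussian of variance [L]. *)
Definition amplitude t := eps * expR (- (2 * L) * (1 - L * precision t)).
Definition profile t x y := 2 * cos (L * precision t * x) ^+ 2 - 1 +
  2 * cos (L * precision t * x) * cos (q * (L * precision t * y)).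

Definition env t x y (a : atom) : R :=
  match a with
  | AX => x
  | AY => y
  | AR => precision t
  | AS => amplitude t
  | AC1 => cos (L * precision t * x)
  | AS1 => sin (L * precision t * x)
  | AC2 => cos (q * (L * precision t * y))
  | AS2 => sin (q * (L * precision t * y))
  | AW => (1 + amplitude t * profile t x y)^-1
  end.

Definition evalE e t x y := evr (env t x y) e.

Local Notation ev := evalE.

Lemma ev_sphiE t x y : ev sphiE t x y = amplitude t * profile t x y.
Proof. by rewrite /evalE /sphiE /phiE /= /profile; ring. Qed.

Section TimeFixed.
Variable t : R.
Hypothesis t1 : -1 < t.

Lemma Lt_gt1 : 1 < L + t. Proof. by move: L2 t1; lra. Qed.

Lemma Lt_neq0 : L + t != 0.
Proof. by rewrite gt_eqF//; apply: lt_trans Lt_gt1. Qed.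

Lemma precision_gt0 : 0 < precision t.
Proof. by rewrite invr_gt0; apply: lt_trans Lt_gt1. Qed.

Lemma precision_le1 : precision t <= 1.
Proof. by rewrite invf_le1 ?(ltW Lt_gt1)//; apply: lt_trans Lt_gt1. Qed.

Lemma amplitude_gt0 : 0 < amplitude t. Proof. by rewrite mulr_gt0// expR_gt0. Qed.

Lemma amplitude_le : amplitude t <= 6^-1.
Proof.
(* This exponent decreases in [t]; at [t = -1] it is [2 L / (L - 1)], at most 4 because [L >= 2]. *)
have h : - (2 * L) * (1 - L * precision t) <= 4.
  have -> : - (2 * L) * (1 - L * precision t) = - (2 * L * t / (L + t)).
    by rewrite /precision; field; exact: Lt_neq0.
  have p : 0 < L + t by apply: lt_trans Lt_gt1.
  by rewrite lerNl ler_pdivlMr//; have := t1; have := L2; nra.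
apply: (@le_trans _ _ (expR (- 4) / 6 * expR 4)).
  by rewrite /amplitude ler_pM ?expR_ge0 ?ler_expR// ltW.
by rewrite mulrAC -expRD addNr expR0 mul1r.
Qed.

Lemma norm_profile x y : `|profile t x y| <= 3.
Proof.
rewrite /profile; have := norm_cos (L * precision t * x); have := norm_cos (q * (L * precision t * y)).
move: (cos _) => a; move: (cos _) => b; rewrite !ler_norml => /andP[a1 a2] /andP[b1 b2].
by apply/andP; split; nra.
Qed.

Lemma den_ge x y : 2^-1 <= 1 + amplitude t * profile t x y.
Proof.
have := norm_profile x y; have := amplitude_gt0; have := amplitude_le; rewrite ler_norml.
by move=> a b /andP[c d]; nra.
Qed.

Lemma den_gt0 x y : 0 < 1 + amplitude t * profile t x y.
Proof. by apply: lt_le_trans (den_ge x y); rewrite invr_gt0. Qed.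

Lemma reg_ev e : reg (ev e t).
Proof.
have rc1 : reg (fun x y => cos (L * precision t * x)).
  apply: (reg_comp (g := cos)); first exact: continuous_cos.
  by apply: regM; [exact: reg_cst|exact: reg_x].
have rs1 : reg (fun x y => sin (L * precision t * x)).
  apply: (reg_comp (g := sin)); first exact: continuous_sin.
  by apply: regM; [exact: reg_cst|exact: reg_x].
have ry : reg (fun x y => q * (L * precision t * y)).
  by apply: regM; [exact: reg_cst|apply: regM; [exact: reg_cst|exact: reg_y]].
have rc2 : reg (fun x y => cos (q * (L * precision t * y))).
  by apply: (reg_comp (g := cos)); first exact: continuous_cos.
have rs2 : reg (fun x y => sin (q * (L * precision t * y))).
  by apply: (reg_comp (g := sin)); first exact: continuous_sin.
have rd : reg (fun x y => 1 + amplitude t * profile t x y).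
  apply: regD; first exact: reg_cst.
  apply: regM; first exact: reg_cst.
  apply: regD; first apply: regD; first by apply: regM; [exact: reg_cst|exact: (regM rc1 rc1)].
    exact: reg_cst.
  by apply: regM => //; apply: regM => //; exact: reg_cst.
elim: e => [c|a|e1 h1 e2 h2|e1 h1 e2 h2].
- exact: reg_cst.
- case: a => //; rewrite /evalE /=.
  + exact: reg_x.
  + exact: reg_y.
  + exact: reg_cst.
  + exact: reg_cst.
  (* Clamping the denominator at its lower bound turns the inverse into a composition with a
     function continuous on the whole line. *)
  have -> : (fun x y => (1 + amplitude t * profile t x y)^-1) =
      (fun x y => (Num.max (1 + amplitude t * profile t x y) 2^-1)^-1).
    by apply/funext => x; apply/funext => y; rewrite max_l// den_ge.
  apply: (reg_comp (g := fun z => (Num.max z 2^-1)^-1)) => //.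
  move=> z; apply: cvgV.
    by rewrite gt_eqF// lt_max invr_gt0 ltr0n orbT.
  apply: (@continuous_max _ _ (fun z : R => z : R^o) (cst (2^-1))).
    exact: cvg_id.
  exact: cvg_cst.
- exact: regD.
- exact: regM.
Qed.

End TimeFixed.

Definition future : set R := [set t | -1 < t].

Lemma subgauss_ev e : subgauss future (ev e).
Proof.
elim: e => [c|a|e1 h1 e2 h2|e1 h1 e2 h2].
- exact: (@subgauss_bounded _ _ _ _ `|c|).
- case: a.
  + exact: subgauss_x.
  + exact: subgauss_y.
  + apply: (@subgauss_bounded _ _ _ _ 1) => t x y t1 /=; rewrite /evalE /=.
    by rewrite ger0_norm ?precision_le1// ltW// precision_gt0.
  + apply: (@subgauss_bounded _ _ _ _ 6^-1) => t x y t1; rewrite /evalE /=.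
    by rewrite ger0_norm ?amplitude_le// ltW// amplitude_gt0.
  + by apply: (@subgauss_bounded _ _ _ _ 1) => t x y t1; exact: norm_cos.
  + by apply: (@subgauss_bounded _ _ _ _ 1) => t x y t1; exact: norm_sin.
  + by apply: (@subgauss_bounded _ _ _ _ 1) => t x y t1; exact: norm_cos.
  + by apply: (@subgauss_bounded _ _ _ _ 1) => t x y t1; exact: norm_sin.
  + apply: (@subgauss_bounded _ _ _ _ 2) => t x y t1; rewrite /evalE /=.
    rewrite ger0_norm ?invr_ge0 ?(ltW (den_gt0 _ _ _))//.
    rewrite -[leRHS]invrK lef_pV2 ?den_ge// posrE ?invr_gt0//.
    exact: den_gt0.
- exact: subgaussD.
- exact: subgaussM.
Qed.

Definition gevalE e t x y := gsq (precision t / 2) x y * ev e t x y.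

Local Notation ge := gevalE.

Lemma tame_ge e t : -1 < t -> tame (ge e t).
Proof.
move=> t1; apply: tame_subgauss.
- by rewrite divr_gt0// precision_gt0.
- exact: reg_ev.
move=> c c0; have [C [C0 hC]] := subgauss_ev e c0.
by exists C; split => // _ x y _; exact: hC.
Qed.

Definition along v e t x y : R -> R :=
  match v with
  | VT => fun s => ev e s x y
  | VX => fun s => ev e t s y
  | VY => fun s => ev e t x s
  end.

Definition coord v t x y : R := match v with VT => t | VX => x | VY => y end.

Lemma along_coord v e t x y : along v e t x y (coord v t x y) = ev e t x y.
Proof. by case: v. Qed.

Lemma alongD v e1 e2 t x y :
  along v (Add e1 e2) t x y = along v e1 t x y \+ along v e2 t x y.
Proof. by case: v. Qed.

Lemma alongM v e1 e2 t x y :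
  along v (Mul e1 e2) t x y = along v e1 t x y \* along v e2 t x y.
Proof. by case: v. Qed.

Section Derivatives.
Variables t x y : R.
Hypothesis t1 : -1 < t.

Lemma is_derive_precision : is_derive t 1 precision (- precision t ^+ 2).
Proof.
have d : is_derive t 1 (fun t => L + t) (1 : R) by exact: is_derive_addl.
apply: (is_derive_eq (is_deriveV (Lt_neq0 t1) d)).
by rewrite /GRing.scale /= /precision; field; exact: Lt_neq0.
Qed.

Lemma is_derive_amplitude : is_derive t 1 amplitude (- 2 * L ^+ 2 * (precision t ^+ 2 * amplitude t)).
Proof.
have d := is_derive_precision.
have d2 : is_derive t 1 (fun t => - (2 * L) * (1 - L * precision t))
    (- (2 * L) * (L * precision t ^+ 2)).
  by apply: is_derive_eq; rewrite /GRing.scale /=; ring.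
have d3 := @is_derive1_comp _ expR _ t _ _ (is_derive_expR _) d2.
by rewrite /amplitude; apply: is_derive_eq; rewrite /GRing.scale /=; ring.
Qed.

Lemma is_derive_cosM (df z : R) (f : R -> R) : is_derive z 1 f df ->
  is_derive z 1 (fun s => cos (f s)) (- (df * sin (f z))).
Proof.
move=> d; have := @is_derive1_comp _ cos f z _ _ (is_derive_cos _) d.
by move/is_derive_eq; apply; ring.
Qed.

Lemma is_derive_sinM (df z : R) (f : R -> R) : is_derive z 1 f df ->
  is_derive z 1 (fun s => sin (f s)) (df * cos (f z)).
Proof.
move=> d; have := @is_derive1_comp _ sin f z _ _ (is_derive_sin _) d.
by move/is_derive_eq; apply; ring.
Qed.

Lemma is_derive_atom0 v a : a <> AW ->
  is_derive (coord v t x y) 1 (along v (At a) t x y) (ev (datom0 L q v a) t x y).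
Proof.
have dr := is_derive_precision; have ds := is_derive_amplitude.
have d1 : is_derive t 1 (fun t => L * precision t * x) (- (L * x * precision t ^+ 2)).
  by apply: is_derive_eq; rewrite /GRing.scale /=; ring.
have d2 : is_derive t 1 (fun t => q * (L * precision t * y)) (- (q * L * y * precision t ^+ 2)).
  by apply: is_derive_eq; rewrite /GRing.scale /=; ring.
have d3 : is_derive x 1 (fun x => L * precision t * x) (L * precision t).
  by apply: is_derive_eq; rewrite /GRing.scale /=; ring.
have d4 : is_derive y 1 (fun y => q * (L * precision t * y)) (q * L * precision t).
  by apply: is_derive_eq; rewrite /GRing.scale /=; ring.
case: v; case: a => // _; rewrite /along /coord /evalE /=;
  first [ exact: is_derive_cst | exact: is_derive_id
        | by apply: (is_derive_eq dr); ring
        | by apply: (is_derive_eq ds); ring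
        | by apply: (is_derive_eq (is_derive_cosM d1)); ring
        | by apply: (is_derive_eq (is_derive_sinM d1)); ring
        | by apply: (is_derive_eq (is_derive_cosM d2)); ring
        | by apply: (is_derive_eq (is_derive_sinM d2)); ring
        | by apply: (is_derive_eq (is_derive_cosM d3)); ring
        | by apply: (is_derive_eq (is_derive_sinM d3)); ring
        | by apply: (is_derive_eq (is_derive_cosM d4)); ring
        | by apply: (is_derive_eq (is_derive_sinM d4)); ring ].
Qed.

Fixpoint occurs a e : Prop :=
  match e with
  | Cst _ => False
  | At b => b = a
  | Add e1 e2 | Mul e1 e2 => occurs a e1 \/ occurs a e2
  end.

(** Asking only for the atoms that occur allows the use on [sphiE] before the derivative of [AW] is
    known. *)
Lemma is_derive_with v (d : atom -> @expr R) e :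
  (forall a, occurs a e ->
    is_derive (coord v t x y) 1 (along v (At a) t x y) (ev (d a) t x y)) ->
  is_derive (coord v t x y) 1 (along v e t x y) (ev (derive_with d e) t x y).
Proof.
elim: e => [c|a|e1 IH1 e2 IH2|e1 IH1 e2 IH2] H.
- by case: v H => _; exact: is_derive_cst.
- exact: H.
- rewrite alongD; apply: is_deriveD; [apply: IH1|apply: IH2] => a h; apply: H;
    [by left|by right].
- have d1 : is_derive (coord v t x y) 1 (along v e1 t x y) (ev (derive_with d e1) t x y).
    by apply: IH1 => a h; apply: H; left.
  have d2 : is_derive (coord v t x y) 1 (along v e2 t x y) (ev (derive_with d e2) t x y).
    by apply: IH2 => a h; apply: H; right.
  rewrite alongM; apply: (is_derive_eq (is_deriveM d1 d2)).
  by rewrite !along_coord /GRing.scale /evalE /=; ring.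
Qed.

Lemma is_derive_atom v a :
  is_derive (coord v t x y) 1 (along v (At a) t x y) (ev (datom L q v a) t x y).
Proof.
have [->|aW] : a = AW \/ a <> AW by case: a; [right|right|right|right|right|right|right|right|left].
  have d0 : is_derive (coord v t x y) 1 (along v sphiE t x y)
      (ev (derive_with (datom0 L q v) sphiE) t x y).
    apply: is_derive_with => b h; apply: is_derive_atom0 => bW.
    by move: h; rewrite bW /= => h; decompose [or] h.
  have d1 : is_derive (coord v t x y) 1 (fun s => 1 + along v sphiE t x y s)
      (ev (derive_with (datom0 L q v) sphiE) t x y).
    by have := is_deriveD (is_derive_cst (1 : R) (coord v t x y) 1) d0; rewrite add0r.
  have E : along v (At AW) t x y = (fun s => (1 + along v sphiE t x y s)^-1).
    by apply/funext => s; case: v {d0 d1}; rewrite /along ev_sphiE.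
  have n0 : 1 + along v sphiE t x y (coord v t x y) != 0.
    by rewrite along_coord ev_sphiE gt_eqF// den_gt0.
  rewrite E; apply: (is_derive_eq (@is_deriveV _ (fun s => 1 + along v sphiE t x y s) _ _ _ n0 d1)).
  have -> : ev (datom L q v AW) t x y = - 1 * ((1 + amplitude t * profile t x y)^-1 *
      (1 + amplitude t * profile t x y)^-1 * ev (derive_with (datom0 L q v) sphiE) t x y) by [].
  rewrite along_coord ev_sphiE -exprVn /GRing.scale /=.
  by move: (_^-1) (ev _ _ _ _) => z w; ring.
have -> : datom L q v a = datom0 L q v a by case: a aW.
exact: is_derive_atom0.
Qed.

Lemma is_derive_ev v e :
  is_derive (coord v t x y) 1 (along v e t x y) (ev (D v e) t x y).
Proof. by apply: is_derive_with => a _; exact: is_derive_atom. Qed.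

Lemma is_derive_evT e : is_derive t 1 (fun s => ev e s x y) (ev (D VT e) t x y).
Proof. exact: (is_derive_ev VT e). Qed.

Lemma is_derive_evX e : is_derive x 1 (fun s => ev e t s y) (ev (D VX e) t x y).
Proof. exact: (is_derive_ev VX e). Qed.

Lemma is_derive_evY e : is_derive y 1 (fun s => ev e t x s) (ev (D VY e) t x y).
Proof. exact: (is_derive_ev VY e). Qed.

Lemma is_derive_geT e : is_derive t 1 (fun s => ge e s x y) (ge (DE VT e) t x y).
Proof.
have dr := is_derive_precision; have de := is_derive_evT e.
have d1 : is_derive t 1 (fun s => - (precision s / 2) * (x ^+ 2 + y ^+ 2))
    (precision t ^+ 2 / 2 * (x ^+ 2 + y ^+ 2)).
  by apply: is_derive_eq; rewrite /GRing.scale /=; ring.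
have d2 := @is_derive1_comp _ expR _ t _ _ (is_derive_expR _) d1.
apply: (is_derive_eq (is_deriveM d2 de)).
by rewrite /GRing.scale /= /gevalE /gsq /evalE /=; ring.
Qed.

Lemma is_derive_geX e : is_derive x 1 (fun s => ge e t s y) (ge (DE VX e) t x y).
Proof.
have de := is_derive_evX e; have d := is_derive_gsq1 (precision t / 2) x y.
apply: (is_derive_eq (is_deriveM d de)).
by rewrite /GRing.scale /= /gevalE /evalE /=; field.
Qed.

Lemma is_derive_geY e : is_derive y 1 (fun s => ge e t x s) (ge (DE VY e) t x y).
Proof.
have de := is_derive_evY e; have d := is_derive_gsq2 (precision t / 2) x y.
apply: (is_derive_eq (is_deriveM d de)).
by rewrite /GRing.scale /= /gevalE /evalE /=; field.
Qed.

End Derivatives.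

Lemma int2_geX e t : -1 < t -> int2 (ge (DE VX e) t) = 0.
Proof.
move=> t1; apply: (int2_dx (tame_ge e t1) (tame_ge _ t1)) => x y.
exact: is_derive_geX.
Qed.

Lemma int2_geY e t : -1 < t -> int2 (ge (DE VY e) t) = 0.
Proof.
move=> t1; apply: (int2_dy (tame_ge e t1) (tame_ge _ t1)) => x y.
exact: is_derive_geY.
Qed.

Lemma is_derive_int2_ge e t : -1 < t ->
  is_derive t 1 (fun s => int2 (ge e s)) (int2 (ge (DE VT e) t)).
Proof.
move=> t1; pose T := t + 1.
(* Rate of the widest Gaussian in the window [s < T], which dominates all the others there. *)
pose c := (L + T)^-1 / 2.
have LT0 : 0 < L + T by rewrite /T; move: L2 t1; lra.
have c0 : 0 < c by rewrite divr_gt0// invr_gt0.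
have [C hC] := subgauss_gsq (subgauss_ev (DE VT e)) c0.
apply: (@is_derive_int2 _ (ge e) (ge (DE VT e)) (-1) T t C (c / 2)).
- by rewrite t1 /T ltrDl ltr01.
- by rewrite divr_gt0.
- by move=> s /andP[s1 _]; exact/tame_integrable/tame_ge.
- by move=> s x y /andP[s1 _]; exact: is_derive_geT.
- move=> s x y /andP[s1 sT]; apply: le_trans (hC s x y s1).
  rewrite /gevalE !normrM ler_wpM2r// !ger0_norm ?gsq_ge0// ler_expR ler_wpM2r ?addr_ge0 ?sqr_ge0//.
  rewrite lerN2 ler_pM2r ?invr_gt0// lef_pV2 ?posrE//; last exact: lt_trans (Lt_gt1 _).
  by rewrite lerD2l ltW.
Qed.

(* The derivative of a function does not depend on the expression denoting it. *)
Definition sameE e1 e2 := forall t x y, -1 < t -> ev e1 t x y = ev e2 t x y.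

Local Notation same := sameE.

Lemma same_D v e1 e2 : same e1 e2 -> same (D v e1) (D v e2).
Proof.
move=> H t x y t1.
have d1 := is_derive_ev x y t1 v e1; have d2 := is_derive_ev x y t1 v e2.
have n : \forall s \near coord v t x y, along v e1 t x y s = along v e2 t x y s.
  case: v {d1 d2} => /=; [|by near=> s; exact: H|by near=> s; exact: H].
  by near=> s; apply: H; near: s; exact: lt_nbhsr.
have [_ <-] := near_eq_is_derive n d1; by have [_ <-] := d2.
Unshelve. all: by end_near. Qed.

Lemma same_DE v e1 e2 : same e1 e2 -> same (DE v e1) (DE v e2).
Proof.
move=> H t x y t1; have h := same_D v H x y t1; have h' := H t x y t1.
by move: h h'; rewrite /evalE /= => -> ->.
Qed.

Lemma same_commD v w e : same (D v (D w e)) (D w (D v e)).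
Proof. by move=> t x y _; exact: evr_commD. Qed.

Lemma same_int2 e1 e2 t : -1 < t -> same e1 e2 -> int2 (ge e1 t) = int2 (ge e2 t).
Proof.
move=> t1 H; congr int2; apply/funext => x; apply/funext => y.
by rewrite /gevalE H.
Qed.

End Semantics.

(** * Bochner identities: I' = - Q and Q' = - D *)

Section Bochner.
Context {R : realType}.
Variables (L eps q : R).
Hypotheses (L2 : 2 <= L) (eps0 : 0 < eps) (eps1 : eps <= expR (- 4) / 6).
Implicit Types (e a b c g p : @expr R) (v w : var) (t x y : R).

Local Notation D := (@deriveE R L q).
Local Notation DE := (@gderiveE R L q).
Local Notation ev := (@evalE R L eps q).
Local Notation ge := (@gevalE R L eps q).
Local Notation same := (@sameE R L eps q).

Lemma ev_cst (k : R) t x y : ev (Cst k) t x y = k. Proof. by []. Qed.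

Lemma ev_add e1 e2 t x y : ev (Add e1 e2) t x y = ev e1 t x y + ev e2 t x y.
Proof. by []. Qed.

Lemma ev_mul e1 e2 t x y : ev (Mul e1 e2) t x y = ev e1 t x y * ev e2 t x y.
Proof. by []. Qed.

Lemma D_cst v (k : R) : D v (Cst k) = Cst 0. Proof. by []. Qed.

Lemma D_add v e1 e2 : D v (Add e1 e2) = Add (D v e1) (D v e2).
Proof. by []. Qed.

Lemma D_mul v e1 e2 : D v (Mul e1 e2) = Add (Mul (D v e1) e2) (Mul e1 (D v e2)).
Proof. by []. Qed.

Definition evE := (D_cst, D_add, D_mul, ev_cst, ev_add, ev_mul).

Definition heatE a b :=
  Mul (Cst 2^-1) (Add (Add (D VX a) (D VY b)) (Add (Mul a a) (Mul b b))).

Definition carre a b := Add (Mul a a) (Mul b b).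

(* d/dt - laplacian / 2 - grad u . grad, where grad u = (a, b) *)
Definition genE a b p :=
  Add (D VT p) (Neg (Add (Mul (Cst 2^-1) (Add (D VX (D VX p)) (D VY (D VY p))))
                         (Add (Mul a (D VX p)) (Mul b (D VY p))))).

Section HeatScore.
(** For [f] equal to [g] times the Gaussian factor, [(a, b)] is the gradient of [u = log f] and [c]
    its time derivative; [heat] is the heat equation in logarithmic form. Keeping them abstract
    hides the size of the actual score from the computations. *)
Variables a b c g : @expr R.
Hypotheses (gX : same (DE VX g) (Mul g a)) (gY : same (DE VY g) (Mul g b))
  (gT : same (DE VT g) (Mul g c)).
Hypotheses (ba : same (D VX b) (D VY a)) (aT : same (D VT a) (D VX c))
  (bT : same (D VT b) (D VY c)) (heat : same c (heatE a b)).

Lemma same_DE_prod v s p : same (DE v g) (Mul g s) ->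
  same (DE v (Mul g p)) (Mul g (Add (D v p) (Mul s p))).
Proof.
move=> H t x y t1; have := H t x y t1; rewrite /gderiveE !evE => h.
rewrite [LHS](_ : _ = (ev (D v g) t x y + ev (logE v) t x y * ev g t x y) * ev p t x y
  + ev g t x y * ev (D v p) t x y); last by ring.
by rewrite h; ring.
Qed.

Lemma same_DE2_prod v s p : same (DE v g) (Mul g s) ->
  same (DE v (DE v (Mul g p)))
    (Mul g (Add (D v (Add (D v p) (Mul s p))) (Mul s (Add (D v p) (Mul s p))))).
Proof.
move=> H t x y t1; rewrite (same_DE L2 eps0 eps1 v (same_DE_prod p H)) //.
exact: same_DE_prod.
Qed.

(* (d/dt - laplacian / 2) (g p) = g (genE p) because g solves the heat equation. *)
Lemma int2_generator p t : -1 < t ->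
  int2 (ge (DE VT (Mul g p)) t) = int2 (ge (Mul g (genE a b p)) t).
Proof.
move=> t1.
pose lap := Add (DE VX (DE VX (Mul g p))) (DE VY (DE VY (Mul g p))).
have E : same (DE VT (Mul g p)) (Add (Mul (Cst 2^-1) lap) (Mul g (genE a b p))).
  move=> s x y s1; rewrite (same_DE_prod p gT)// /lap.
  rewrite [RHS](_ : _ = 2^-1 * (ev (DE VX (DE VX (Mul g p))) s x y +
    ev (DE VY (DE VY (Mul g p))) s x y) + ev g s x y * ev (genE a b p) s x y)//.
  rewrite /genE /Neg (same_DE2_prod p gX)// (same_DE2_prod p gY)// !evE (heat x y s1) /heatE !evE.
  by field.
rewrite (same_int2 t1 E).
have tI e : integrable2 (ge e t) by exact/tame_integrable/tame_ge.
have -> : ge (Add (Mul (Cst 2^-1) lap) (Mul g (genE a b p))) t = fun x y =>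
    2^-1 * (ge (DE VX (DE VX (Mul g p))) t x y + ge (DE VY (DE VY (Mul g p))) t x y)
    + ge (Mul g (genE a b p)) t x y.
  apply/funext => x; apply/funext => y; rewrite /gevalE /lap.
  rewrite [ev (Add _ _) _ _ _](_ : _ = 2^-1 * (ev (DE VX (DE VX (Mul g p))) t x y +
    ev (DE VY (DE VY (Mul g p))) t x y) + ev (Mul g (genE a b p)) t x y)//.
  by ring.
rewrite int2D//; last by apply: integrable2Z; exact: integrable2D.
rewrite int2Z; last exact: integrable2D.
rewrite int2D// int2_geX// int2_geY// addr0 mulr0 add0r.
by [].
Qed.

Definition hess2E := Add (Add (Mul (D VX a) (D VX a)) (Mul (D VX b) (D VY a)))
                         (Add (Mul (D VY a) (D VX b)) (Mul (D VY b) (D VY b))).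

(** Built from the Hessian of [u], so it is the opposite of the trace for [H_f]. The eight products
    follow the order of the sums in [trH3]. *)
Definition trace3E :=
  Add (Add (Add (Mul (Mul (D VX a) (D VX a)) (D VX a))
                (Mul (Mul (D VX a) (D VX b)) (D VY a)))
           (Add (Mul (Mul (D VX b) (D VY a)) (D VX a))
                (Mul (Mul (D VX b) (D VY b)) (D VY a))))
      (Add (Add (Mul (Mul (D VY a) (D VX a)) (D VX b))
                (Mul (Mul (D VY a) (D VX b)) (D VY b)))
           (Add (Mul (Mul (D VY b) (D VY a)) (D VX b))
                (Mul (Mul (D VY b) (D VY b)) (D VY b)))).

Definition Sqr e := Mul e e.

Definition grad2E :=
  Add (Add (Add (Sqr (D VX (D VX a))) (Sqr (D VY (D VX a))))
           (Add (Sqr (D VX (D VX b))) (Sqr (D VY (D VX b)))))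
      (Add (Add (Sqr (D VX (D VY a))) (Sqr (D VY (D VY a))))
           (Add (Sqr (D VX (D VY b))) (Sqr (D VY (D VY b))))).

Lemma ev_DDbX t x y w : -1 < t -> ev (D w (D VX b)) t x y = ev (D w (D VY a)) t x y.
Proof. exact: (same_D L2 eps0 eps1 w ba). Qed.

Lemma ev_DTa t x y : -1 < t -> ev (D VT a) t x y =
  2^-1 * (ev (D VX (D VX a)) t x y + ev (D VY (D VY a)) t x y) +
  ev a t x y * ev (D VX a) t x y + ev b t x y * ev (D VY a) t x y.
Proof.
move=> t1; rewrite aT// (same_D L2 eps0 eps1 VX heat)// /heatE !evE.
rewrite same_commD// ev_DDbX// ba//.
by field.
Qed.

Lemma ev_DTb t x y : -1 < t -> ev (D VT b) t x y =
  2^-1 * (ev (D VX (D VX b)) t x y + ev (D VY (D VY b)) t x y) +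
  ev a t x y * ev (D VX b) t x y + ev b t x y * ev (D VY b) t x y.
Proof.
move=> t1; rewrite bT// (same_D L2 eps0 eps1 VY heat)// /heatE !evE.
rewrite same_commD// -ev_DDbX// ba//.
by field.
Qed.

(** Differentiating the heat equation for [u] in space gives [genE a = genE b = 0], so in
    [genE (a^2 + b^2)] only the carre du champ [- |grad a|^2 - |grad b|^2] survives. *)
Lemma gen_carre : same (genE a b (carre a b)) (Neg hess2E).
Proof.
move=> t x y t1; rewrite /genE /carre /hess2E /Neg !evE ev_DTa// ev_DTb// ba//.
by field.
Qed.

Lemma gen_mul e1 e2 t x y : ev (genE a b (Mul e1 e2)) t x y =
  ev e1 t x y * ev (genE a b e2) t x y + ev e2 t x y * ev (genE a b e1) t x y -
  (ev (D VX e1) t x y * ev (D VX e2) t x y + ev (D VY e1) t x y * ev (D VY e2) t x y).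
Proof. by rewrite /genE /Neg !evE; field. Qed.

Lemma gen_add e1 e2 t x y : ev (genE a b (Add e1 e2)) t x y =
  ev (genE a b e1) t x y + ev (genE a b e2) t x y.
Proof. by rewrite /genE /Neg !evE; field. Qed.

Lemma ev_commDD w v e t x y : -1 < t -> ev (D w (D v (D v e))) t x y = ev (D v (D v (D w e))) t x y.
Proof.
move=> t1; rewrite (@same_commD _ L eps q w v (D v e))//.
exact: (same_D L2 eps0 eps1 v (@same_commD _ L eps q w v e)).
Qed.

(** Apply [D w] to [genE a = 0]: the commutator comes only from the drift [grad u], whose derivative
    is a row of the Hessian [M] of [u]. Together with [gen_Db] this says [genE M = M^2]
    entrywise. *)
Lemma gen_Da w t x y : -1 < t -> ev (genE a b (D w a)) t x y =
  ev (D w a) t x y * ev (D VX a) t x y + ev (D w b) t x y * ev (D VY a) t x y.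
Proof.
move=> t1; pose r := Add (Mul (Cst 2^-1) (Add (D VX (D VX a)) (D VY (D VY a))))
  (Add (Mul a (D VX a)) (Mul b (D VY a))).
have h : same (D VT a) r.
  by move=> s u z s1; rewrite /r !ev_add !ev_mul ev_cst ev_DTa// addrA.
rewrite /genE /Neg !evE same_commD// (same_D L2 eps0 eps1 w h)// /r !evE.
rewrite !ev_commDD// (@same_commD _ L eps q VX w)// (@same_commD _ L eps q VY w)//.
by field.
Qed.

Lemma gen_Db w t x y : -1 < t -> ev (genE a b (D w b)) t x y =
  ev (D w a) t x y * ev (D VX b) t x y + ev (D w b) t x y * ev (D VY b) t x y.
Proof.
move=> t1; pose r := Add (Mul (Cst 2^-1) (Add (D VX (D VX b)) (D VY (D VY b))))
  (Add (Mul a (D VX b)) (Mul b (D VY b))).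
have h : same (D VT b) r.
  by move=> s u z s1; rewrite /r !ev_add !ev_mul ev_cst ev_DTb// addrA.
rewrite /genE /Neg !evE same_commD// (same_D L2 eps0 eps1 w h)// /r !evE.
rewrite !ev_commDD// (@same_commD _ L eps q VX w)// (@same_commD _ L eps q VY w)//.
by field.
Qed.

(** From [genE M = M^2], the product rule [gen_mul] applied to [tr M^2] yields [2 tr M^3] minus the
    squared gradients of the entries. *)
Lemma gen_hess2 : same (genE a b hess2E) (Add (Mul (Cst 2) trace3E) (Neg grad2E)).
Proof.
move=> t x y t1; rewrite /hess2E !gen_add !gen_mul !gen_Da// !gen_Db//.
rewrite /trace3E /grad2E /Sqr /Neg !(ev_add, ev_mul, ev_cst).
rewrite !ev_DDbX// ba//; ring.
Qed.

Lemma ev_carre t x y : ev (carre a b) t x y = ev a t x y ^+ 2 + ev b t x y ^+ 2.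
Proof. by rewrite !expr2. Qed.

Lemma ev_hess2E t x y : ev hess2E t x y =
  ev (D VX a) t x y * ev (D VX a) t x y + ev (D VX b) t x y * ev (D VY a) t x y +
  (ev (D VY a) t x y * ev (D VX b) t x y + ev (D VY b) t x y * ev (D VY b) t x y).
Proof. by []. Qed.

Lemma ev_trace3E t x y : ev trace3E t x y =
  let aX := ev (D VX a) t x y in let aY := ev (D VY a) t x y in
  let bX := ev (D VX b) t x y in let bY := ev (D VY b) t x y in
  aX * aX * aX + aX * bX * aY + (bX * aY * aX + bX * bY * aY) +
  (aY * aX * bX + aY * bX * bY + (bY * aY * bX + bY * bY * bY)).
Proof. by []. Qed.

Lemma ev_grad2E t x y : ev grad2E t x y =
  ev (D VX (D VX a)) t x y ^+ 2 + ev (D VY (D VX a)) t x y ^+ 2 +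
  (ev (D VX (D VX b)) t x y ^+ 2 + ev (D VY (D VX b)) t x y ^+ 2) +
  (ev (D VX (D VY a)) t x y ^+ 2 + ev (D VY (D VY a)) t x y ^+ 2 +
  (ev (D VX (D VY b)) t x y ^+ 2 + ev (D VY (D VY b)) t x y ^+ 2)).
Proof. by rewrite !expr2. Qed.

(** Both sides are the Laplacian of the density, relative to the Gaussian factor; its zero integral
    identifies [calI] with the Fisher information. *)
Lemma same_div : same (Add (DE VX (Mul g a)) (DE VY (Mul g b)))
  (Add (Mul g (Add (D VX a) (D VY b))) (Mul g (carre a b))).
Proof.
move=> t x y t1; rewrite [LHS](_ : _ = ev (DE VX (Mul g a)) t x y + ev (DE VY (Mul g b)) t x y)//.
rewrite (same_DE_prod a gX)// (same_DE_prod b gY)// /carre !(ev_mul, ev_add).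
by ring.
Qed.

End HeatScore.

Lemma q_rel (q2 : q ^+ 2 = 3) t x y : ev (scoreE L q VT) t x y =
  ev (heatE (scoreE L q VX) (scoreE L q VY)) t x y.
Proof.
rewrite /evalE (@evr_score_heat _ L q (env L eps q t x y) q2); last first.
  by rewrite /= -(cos2Dsin2 (L * precision L t * x)); ring.
by rewrite /heatE /=; ring.
Qed.

Variable n : R.
Hypothesis q2 : q ^+ 2 = 3.

Local Notation a := (scoreE L q VX).
Local Notation b := (scoreE L q VY).
Definition densE := Mul (Mul (Cst n) (At AR)) (Add (Cst 1) (@sphiE R)).

Lemma same_DE_dens v : same (DE v densE) (Mul densE (scoreE L q v)).
Proof.
move=> t x y t1.
pose S := ev (@sphiE R) t x y; pose dS := ev (D v (@sphiE R)) t x y.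
pose r := precision L t; pose W := ev (At AW) t x y; pose dr := ev (datom L q v AR) t x y.
pose l := ev (logE v) t x y.
have W1 : W * (1 + S) = 1.
  by rewrite /W /S ev_sphiE /evalE /= mulVf// gt_eqF// den_gt0.
transitivity ((0 * r + n * dr) * (1 + S) + n * r * (0 + dS) + l * (n * r * (1 + S))) => //.
transitivity (n * r * (1 + S) * (l + ((match v with VT => - 1 * r | _ => 0 end) + W * dS))); last first.
  by case: v @dS @dr @l.
have -> : dr = (match v with VT => - 1 * (r * r) | _ => 0 end) by case: v {l dS} @dr.
(* The derivative of the perturbation lacks the factor [1 + S] of the density; [W (1 + S) = 1]
   supplies it. *)
rewrite [in LHS](_ : dS = dS * (W * (1 + S))); last by rewrite W1 mulr1.
by case: v @dS @dr @l => dS dr l; ring.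
Qed.

Lemma score_dxy v w : same (D v (scoreE L q w)) (D w (scoreE L q v)).
Proof. by move=> t x y _; exact: evr_score_sym. Qed.

Lemma is_derive_carre t : -1 < t ->
  is_derive t 1 (fun s => int2 (ge (Mul densE (carre a b)) s))
    (int2 (ge (Mul densE (Neg (hess2E a b))) t)).
Proof.
move=> t1.
have -> : int2 (ge (Mul densE (Neg (hess2E a b))) t) = int2 (ge (DE VT (Mul densE (carre a b))) t).
  rewrite (int2_generator (same_DE_dens VX) (same_DE_dens VY) (same_DE_dens VT) (fun t x y _ => q_rel q2 t x y))//.
  apply: same_int2 t1 _ => s x y s1; rewrite !ev_mul; congr (_ * _).
  apply/esym/(gen_carre (c := scoreE L q VT)) => //; try exact: score_dxy.
  by move=> ? ? ? _; exact: q_rel.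
exact: is_derive_int2_ge.
Qed.

Lemma is_derive_hess2 t : -1 < t ->
  is_derive t 1 (fun s => int2 (ge (Mul densE (hess2E a b)) s))
    (int2 (ge (Mul densE (Add (Mul (Cst 2) (trace3E a b)) (Neg (grad2E a b)))) t)).
Proof.
move=> t1.
have -> : int2 (ge (Mul densE (Add (Mul (Cst 2) (trace3E a b)) (Neg (grad2E a b)))) t) = int2 (ge (DE VT (Mul densE (hess2E a b))) t).
  rewrite (int2_generator (same_DE_dens VX) (same_DE_dens VY) (same_DE_dens VT) (fun t x y _ => q_rel q2 t x y))//.
  apply: same_int2 t1 _ => s x y s1; rewrite !ev_mul; congr (_ * _).
  apply/esym/(gen_hess2 (c := scoreE L q VT)) => //; try exact: score_dxy.
  by move=> ? ? ? _; exact: q_rel.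
exact: is_derive_int2_ge.
Qed.

End Bochner.

(** * The functionals of the perturbed Gaussian *)

Section HeatFlow.
Context {R : realType}.
Variables (L eps q n : R).
Hypotheses (L2 : 2 <= L) (eps0 : 0 < eps) (eps1 : eps <= expR (- 4) / 6).
Hypotheses (q2 : q ^+ 2 = 3) (n0 : 0 < n).
Implicit Types (e : @expr R) (v w : var) (t x y : R).

Local Notation D := (@deriveE R L q).
Local Notation DE := (@gderiveE R L q).
Local Notation ev := (@evalE R L eps q).
Local Notation ge := (@gevalE R L eps q).
Local Notation same := (@sameE R L eps q).
Local Notation dens := (@densE R n).
Local Notation score := (@scoreE R L q).
Local Notation a := (score VX).
Local Notation b := (score VY).
Local Notation dissE :=
  (Neg (Add (Mul (Cst 2) (trace3E L q a b)) (Neg (grad2E L q a b)))).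

Let N1 : -1 < 0 :> R. Proof. by rewrite ltrN10. Qed.

Lemma ge_mul e1 e2 t x y : ge (Mul e1 e2) t x y = ge e1 t x y * ev e2 t x y.
Proof. by rewrite /gevalE ev_mul mulrA. Qed.

Lemma ge_add e1 e2 t x y : ge (Add e1 e2) t x y = ge e1 t x y + ge e2 t x y.
Proof. by rewrite /gevalE ev_add mulrDr. Qed.

Lemma ge_densE t x y :
  ge dens t x y = gsq (precision L t / 2) x y * (n * precision L t * (1 + amplitude L eps t * profile L q t x y)).
Proof. by rewrite /gevalE -ev_sphiE. Qed.

Lemma ge_dens_gt0 t x y : -1 < t -> 0 < ge dens t x y.
Proof.
move=> t1; rewrite ge_densE mulr_gt0 ?expR_gt0// mulr_gt0// ?den_gt0//.
by rewrite mulr_gt0// (precision_gt0 L2 t1).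
Qed.

Let dgeX e t x y (t1 : -1 < t) : is_derive x 1 (fun s => ge e t s y) (ge (DE VX e) t x y).
Proof. exact: is_derive_geX. Qed.

Let dgeY e t x y (t1 : -1 < t) : is_derive y 1 (fun s => ge e t x s) (ge (DE VY e) t x y).
Proof. exact: is_derive_geY. Qed.

Let devX e t x y (t1 : -1 < t) : is_derive x 1 (fun s => ev e t s y) (ev (D VX e) t x y).
Proof. exact: is_derive_evX. Qed.

Let devY e t x y (t1 : -1 < t) : is_derive y 1 (fun s => ev e t x s) (ev (D VY e) t x y).
Proof. exact: is_derive_evY. Qed.

Definition vari (i : 'I_2) : var := if i == ord0 then VX else VY.

Lemma partial1_ge e t : -1 < t -> partial1 (ge e t) = ge (DE VX e) t.
Proof.
move=> t1; apply/funext => x; apply/funext => y; rewrite /partial1 derive1E.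
by have [_ ->] := dgeX e x y t1.
Qed.

Lemma partial2_ge e t : -1 < t -> partial2 (ge e t) = ge (DE VY e) t.
Proof.
move=> t1; apply/funext => x; apply/funext => y; rewrite /partial2 derive1E.
by have [_ ->] := dgeY e x y t1.
Qed.

Lemma pd_ge i e t : -1 < t -> pd i (ge e t) = ge (DE (vari i) e) t.
Proof.
by move=> t1; rewrite /pd /vari; case: ifP => _; [exact: partial1_ge|exact: partial2_ge].
Qed.

Lemma pd_ev i e t : -1 < t -> pd i (ev e t) = ev (D (vari i) e) t.
Proof.
move=> t1; rewrite /pd /vari; case: ifP => _; apply/funext => x; apply/funext => y.
- rewrite /partial1 derive1E.
  by have [_ ->] := devX e x y t1.
- rewrite /partial2 derive1E.
  by have [_ ->] := devY e x y t1.
Qed.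

Lemma pd_opp_ev i e t : -1 < t ->
  pd i (fun x y => - ev e t x y) = (fun x y => - ev (D (vari i) e) t x y).
Proof.
move=> t1; have -> : (fun x y => - ev e t x y) = ev (Neg e) t.
  by apply/funext => x; apply/funext => y; rewrite /Neg ev_mul ev_cst mulN1r.
rewrite pd_ev//; apply/funext => x; apply/funext => y.
by rewrite /Neg !evE mul0r add0r mulN1r.
Qed.

(** Partial derivatives of any order stay in the family [ge e' t], so first-order differentiability
    and continuity of its members suffice. *)
Lemma smooth_ge e t : -1 < t -> smooth2 (ge e t).
Proof.
move=> t1 l.
have [e' E] : exists e', dpart l (ge e t) = ge e' t.
  by elim: l => [|i l [e' IH]]; [exists e|exists (DE (vari i) e'); rewrite /= IH pd_ge].
rewrite E => x y; split; [|split].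
- by have [] := dgeX e' x y t1.
- by have [] := dgeY e' x y t1.
- have rge e0 : reg (ev e0 t) by exact: reg_ev.
  have [_ c] := regM (reg_gsq (precision L t / 2)) (rge e').
  exact: c.
Qed.

Lemma ge_DE_dens v t x y : -1 < t -> ge (DE v dens) t x y = ge dens t x y * ev (score v) t x y.
Proof. by move=> t1; rewrite {1}/gevalE same_DE_dens// -ge_mul. Qed.

Lemma pd_ln_dens i t : -1 < t ->
  pd i (fun x y => ln (ge dens t x y)) = ev (score (vari i)) t.
Proof.
move=> t1; rewrite /pd /vari.
have g0 x y := ge_dens_gt0 x y t1.
case: ifP => _; apply/funext => x; apply/funext => y.
- have d := dgeX dens x y t1.
  have d2 := @is_derive1_comp _ (@ln R) (fun s => ge dens t s y) x _ _ (is_derive1_ln (g0 x y)) d.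
  rewrite /partial1 derive1E; have [_ ->] := d2.
  by rewrite ge_DE_dens// mulrA mulVf ?mul1r// gt_eqF.
- have d := dgeY dens x y t1.
  have d2 := @is_derive1_comp _ (@ln R) (fun s => ge dens t x s) y _ _ (is_derive1_ln (g0 x y)) d.
  rewrite /partial2 derive1E; have [_ ->] := d2.
  by rewrite ge_DE_dens// mulrA mulVf ?mul1r// gt_eqF.
Qed.

Lemma Hf_dens i j t : -1 < t ->
  Hf (ge dens t) i j = (fun x y => - ev (D (vari i) (score (vari j))) t x y).
Proof.
by move=> t1; apply/funext => x; apply/funext => y; rewrite /Hf pd_ln_dens// pd_ev.
Qed.

Lemma calI_integrandE t : -1 < t -> calI_integrand (ge dens t) =
  ge (Mul dens (Neg (Add (D VX a) (D VY b)))) t.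
Proof.
move=> t1; apply/funext => x; apply/funext => y.
rewrite /calI_integrand /trH !big_ord_recl big_ord0 !(Hf_dens _ _ t1).
by rewrite ge_mul /Neg ev_mul ev_add ev_cst /vari /=; ring.
Qed.

Lemma calQ_integrandE t : -1 < t -> calQ_integrand (ge dens t) =
  ge (Mul dens (hess2E L q a b)) t.
Proof.
move=> t1; apply/funext => x; apply/funext => y.
pose H i j := - ev (D (vari i) (score (vari j))) t x y.
have HE i j : Hf (ge dens t) i j x y = H i j by rewrite Hf_dens.
transitivity ((\sum_(i < 2) \sum_(j < 2) H i j * H j i) * ge dens t x y).
  by congr (_ * _); apply: eq_bigr => i _; apply: eq_bigr => j _; rewrite !HE.
rewrite !big_ord_recl !big_ord0 ge_mul ev_hess2E.
have [H00 [H01 [H10 H11]]] : H ord0 ord0 = - ev (D VX a) t x y /\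
    H ord0 (lift ord0 ord0) = - ev (D VX b) t x y /\
    H (lift ord0 ord0) ord0 = - ev (D VY a) t x y /\
    H (lift ord0 ord0) (lift ord0 ord0) = - ev (D VY b) t x y by [].
rewrite H00 H01 H10 H11.
move: (ge _ _ _ _) (ev _ _ _ _) (ev _ _ _ _) (ev _ _ _ _) (ev _ _ _ _) => *.
by ring.
Qed.

Lemma calD_integrandE t : -1 < t -> calD_integrand (ge dens t) =
  ge (Mul dens dissE) t.
Proof.
move=> t1; apply/funext => x; apply/funext => y.
pose H i j := - ev (D (vari i) (score (vari j))) t x y.
pose T i j k := - ev (D (vari k) (D (vari i) (score (vari j)))) t x y.
have HE i j : Hf (ge dens t) i j x y = H i j by rewrite Hf_dens.
have TE i j k : pd k (Hf (ge dens t) i j) x y = T i j k.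
  by rewrite Hf_dens// pd_opp_ev.
transitivity ((\sum_(i < 2) \sum_(j < 2) \sum_(k < 2) T i j k ^+ 2 +
    2 * \sum_(i < 2) \sum_(j < 2) \sum_(k < 2) H i j * H j k * H k i) * ge dens t x y).
  congr ((_ + 2 * _) * _); apply: eq_bigr => i _; apply: eq_bigr => j _; apply: eq_bigr => k _.
  - by rewrite TE.
  - by rewrite !HE.
rewrite !big_ord_recl !big_ord0 ge_mul.
rewrite [ev (Neg _) _ _ _](_ : _ = - 1 * (2 * ev (trace3E L q a b) t x y + - 1 * ev (grad2E L q a b) t x y))//.
rewrite ev_trace3E ev_grad2E /=.
have [H00 [H01 [H10 H11]]] : H ord0 ord0 = - ev (D VX a) t x y /\
    H ord0 (lift ord0 ord0) = - ev (D VX b) t x y /\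
    H (lift ord0 ord0) ord0 = - ev (D VY a) t x y /\
    H (lift ord0 ord0) (lift ord0 ord0) = - ev (D VY b) t x y by [].
have [T0 [T1 [T2 T3]]] : T ord0 ord0 ord0 = - ev (D VX (D VX a)) t x y /\
    T ord0 ord0 (lift ord0 ord0) = - ev (D VY (D VX a)) t x y /\
    T ord0 (lift ord0 ord0) ord0 = - ev (D VX (D VX b)) t x y /\
    T ord0 (lift ord0 ord0) (lift ord0 ord0) = - ev (D VY (D VX b)) t x y by [].
have [T4 [T5 [T6 T7]]] : T (lift ord0 ord0) ord0 ord0 = - ev (D VX (D VY a)) t x y /\
    T (lift ord0 ord0) ord0 (lift ord0 ord0) = - ev (D VY (D VY a)) t x y /\
    T (lift ord0 ord0) (lift ord0 ord0) ord0 = - ev (D VX (D VY b)) t x y /\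
    T (lift ord0 ord0) (lift ord0 ord0) (lift ord0 ord0) = - ev (D VY (D VY b)) t x y by [].
rewrite H00 H01 H10 H11 T0 T1 T2 T3 T4 T5 T6 T7.
move: (ge _ _ _ _) (ev (D VX a) t x y) (ev (D VX b) t x y) (ev (D VY a) t x y) (ev (D VY b) t x y) => *.
move: (ev (D VX (D VX a)) t x y) (ev (D VY (D VX a)) t x y) (ev (D VX (D VX b)) t x y)
  (ev (D VY (D VX b)) t x y) (ev (D VX (D VY a)) t x y) (ev (D VY (D VY a)) t x y)
  (ev (D VX (D VY b)) t x y) (ev (D VY (D VY b)) t x y) => *.
by ring.
Qed.

Lemma fisher_integrandE t : -1 < t -> fisher_integrand (ge dens t) =
  ge (Mul dens (carre a b)) t.
Proof.
move=> t1; apply/funext => x; apply/funext => y.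
rewrite /fisher_integrand partial1_ge// partial2_ge// !ge_DE_dens// ge_mul ev_carre.
have := ge_dens_gt0 x y t1; move: (ge _ _ _ _) (ev a t x y) (ev b t x y) => g u w g0.
by field; rewrite gt_eqF.
Qed.

(** The constant 1 is taken as the wave of zero wave vector, so that [int2_heat_wave] evolves all
    four terms alike. *)
Lemma sum_waves (z X Y : R) :
  cos (0 * X + 0 * Y) + z * (cos (2 * X + 0 * Y) + (cos (1 * X + q * Y) + cos (1 * X + - q * Y))) =
  1 + z * (2 * cos X ^+ 2 - 1 + 2 * cos X * cos (q * Y)).
Proof.
rewrite !mul0r !addr0 cos0 !mul1r mulNr cosB cosD; congr (_ + z * _).
have -> : cos (2 * X) = 2 * cos X ^+ 2 - 1.
  by rewrite mulr_natl cos_mulr2n mulr_natl.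
by ring.
Qed.

Lemma heat_dens t : 0 < t -> heat (ge dens 0) t = ge dens t.
Proof.
move=> t0; apply/funext => x; apply/funext => y; rewrite /heat t0.
have L0 : 0 < L by apply: lt_le_trans L2.
have Lt0 : 0 < L + t by rewrite addr_gt0.
have L1 : L * precision L 0 = 1 by rewrite /precision addr0 mulfV// gt_eqF.
pose h k l : fun2 R := fun a b => gsq (2 * L)^-1 (x - a) (y - b) *
              cos (k * (x - a) + l * (y - b)) * gauss2 t a b.
have ih k l : integrable2 (h k l) by exact: integrable_heat_wave.
have -> : (fun a b => ge dens 0 (x - a) (y - b) * gauss2 t a b) =
  (fun a b => n / L * (h 0 0 a b + eps * (h 2 0 a b + (h 1 q a b + h 1 (- q) a b)))).
  apply/funext => u; apply/funext => w; rewrite ge_densE /profile L1 !mul1r /amplitude L1 subrr mulr0 expR0 mulr1.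
  rewrite -sum_waves /h /precision addr0 (_ : L^-1 / 2 = (2 * L)^-1); last by rewrite invfM mulrC.
  by ring.
have ih2 : integrable2 (fun a b => h 1 q a b + h 1 (- q) a b) by exact: integrable2D.
have ih3 : integrable2 (fun a b => h 2 0 a b + (h 1 q a b + h 1 (- q) a b)) by exact: integrable2D.
have ih4 : integrable2 (fun a b => eps * (h 2 0 a b + (h 1 q a b + h 1 (- q) a b))).
  exact: integrable2Z.
rewrite int2Z; last exact: integrable2D.
rewrite int2D// int2Z// int2D// int2D// !int2_heat_wave//.
pose z := expR (- (2 * (t * L / (L + t)))).
(* Equal lengths give one common damping factor: the flow changes only the width, the spatial scale
   and the amplitude, and remains of the form [ge dens t]. *)
have E4 k l : k ^+ 2 + l ^+ 2 = 4 -> expR (- ((k ^+ 2 + l ^+ 2) * (t * L / (L + t)) / 2)) = z.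
  by move=> ->; rewrite /z; congr expR; field; rewrite gt_eqF.
have E0 : expR (- ((0 ^+ 2 + 0 ^+ 2) * (t * L / (L + t)) / 2)) = 1.
  by rewrite expr0n addr0 !mul0r oppr0 expR0.
rewrite E0 !E4; first last.
- by ring.
- by rewrite q2; ring.
- by rewrite sqrrN q2; ring.
set X := L / (L + t) * x; set Y := L / (L + t) * y; set G := gsq _ x y.
rewrite [LHS](_ : _ = n / (L + t) * G * (cos (0 * X + 0 * Y) + eps * z *
  (cos (2 * X + 0 * Y) + (cos (1 * X + q * Y) + cos (1 * X + - q * Y))))); last first.
  by move: (cos _) (cos _) (cos _) (cos _) => c1 c2 c3 c4; field; rewrite !gt_eqF.
rewrite sum_waves ge_densE /G -/(precision L t) (_ : (2 * (L + t))^-1 = precision L t / 2); last first.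
  by rewrite invfM mulrC.
have -> : eps * z = amplitude L eps t.
  by rewrite /amplitude /z; congr (_ * expR _); rewrite /precision; field; rewrite gt_eqF.
by rewrite /profile -/X -/Y /precision; ring.
Qed.

Lemma heat_dens_ge0 t : 0 <= t -> heat (ge dens 0) t = ge dens t.
Proof.
rewrite le_eqVlt => /orP[/eqP <-|]; last exact: heat_dens.
by apply/funext => x; apply/funext => y; rewrite /heat ltxx.
Qed.

(** [heat] is frozen at [f] for [t <= 0], whereas the explicit density continues to [t > -1]. Thus
    [fisherF], which equals [fisherI] for [t >= 0], has two-sided derivatives at 0, and the
    one-sided ones follow. *)
Definition fisherF t := int2 (ge (Mul dens (carre a b)) t).
Definition hessF t := int2 (ge (Mul dens (hess2E L q a b)) t).
Definition dissF t :=
  int2 (ge (Mul dens dissE) t).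

Lemma fisherI_dens t : 0 <= t -> fisherI (ge dens 0) t = fisherF t.
Proof.
move=> t0; rewrite /fisherI /fisher heat_dens_ge0// fisher_integrandE//.
exact: lt_le_trans t0.
Qed.

Lemma int2_ge_Neg e t : -1 < t -> int2 (ge (Mul dens (Neg e)) t) = - int2 (ge (Mul dens e) t).
Proof.
move=> t1; rewrite -int2N; last exact/tame_integrable/tame_ge.
congr int2; apply/funext => x; apply/funext => y.
by rewrite !ge_mul /Neg ev_mul ev_cst; ring.
Qed.

Lemma is_derive_fisherF t : -1 < t -> is_derive t 1 fisherF (- hessF t).
Proof. by move=> t1; rewrite /hessF -int2_ge_Neg//; exact: is_derive_carre. Qed.

Lemma is_derive_hessF t : -1 < t -> is_derive t 1 hessF (- dissF t).
Proof.
move=> t1; rewrite /dissF int2_ge_Neg// opprK.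
exact: is_derive_hess2.
Qed.

Lemma calI_dens : calI (ge dens 0) = fisherF 0.
Proof.
rewrite /calI calI_integrandE// int2_ge_Neg//.
have tI e : integrable2 (ge e 0) by exact/tame_integrable/tame_ge.
have dX : same (DE VX dens) (Mul dens a) by exact: same_DE_dens.
have dY : same (DE VY dens) (Mul dens b) by exact: same_DE_dens.
have E : (fun x y => ge (DE VX (Mul dens a)) 0 x y + ge (DE VY (Mul dens b)) 0 x y) =
    (fun x y => ge (Mul dens (Add (D VX a) (D VY b))) 0 x y + ge (Mul dens (carre a b)) 0 x y).
  apply/funext => x; apply/funext => y.
  have h := same_div dX dY x y N1.
  by rewrite -!ge_add /gevalE h.
have := congr1 (@int2 R) E; rewrite !int2D// int2_geX// int2_geY// addr0.
by move=> /eqP; rewrite eq_sym addr_eq0 => /eqP ->; rewrite opprK.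
Qed.

Lemma calQ_dens : calQ (ge dens 0) = hessF 0.
Proof. by rewrite /calQ calQ_integrandE. Qed.

Lemma calD_dens : calD (ge dens 0) = dissF 0.
Proof. by rewrite /calD calD_integrandE. Qed.

Lemma right_slope (F : R -> R) (d : R) : is_derive (0 : R) 1 F d ->
  ((fun h => (F h - F 0) / h) @ 0^'+ --> d).
Proof.
move=> [dF <-].
have /cvg_dnbhs_at_right : (fun h : R => h^-1 *: (F (h *: 1 + 0) - F 0)) @ 0^' --> 'D_1 F 0.
  exact: dF.
apply: cvg_trans; apply: near_eq_cvg; near=> h.
by rewrite addr0 /GRing.scale /= mulr1 mulrC.
Unshelve. all: by end_near. Qed.

Lemma derive_fisherI t : 0 < t -> is_derive t 1 (fisherI (ge dens 0)) (- hessF t).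
Proof.
move=> t0; apply: near_eq_is_derive (is_derive_fisherF (lt_trans N1 t0)).
near=> s; rewrite fisherI_dens//; near: s.
by apply: filterS (lt_nbhsr t0) => s; exact: ltW.
Unshelve. all: by end_near. Qed.

Lemma derive1_fisherI t : 0 < t -> derive1 (fisherI (ge dens 0)) t = - hessF t.
Proof. by move=> t0; rewrite derive1E; have [_ ->] := derive_fisherI t0. Qed.

Lemma is_derive_derive1_fisherI t : 0 < t ->
  is_derive t 1 (derive1 (fisherI (ge dens 0))) (dissF t).
Proof.
move=> t0.
have d : is_derive t 1 (fun s => - hessF s) (dissF t).
  by rewrite -[dissF t]opprK; apply: is_deriveN; apply: is_derive_hessF; exact: lt_trans N1 t0.
apply: near_eq_is_derive d; near=> s; rewrite derive1_fisherI//; near: s.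
exact: lt_nbhsr.
Unshelve. all: by end_near. Qed.

Lemma fisherI_slope :
  ((fun h => (fisherI (ge dens 0) h - fisherI (ge dens 0) 0) / h) @ 0^'+ --> - hessF 0).
Proof.
apply: cvg_trans (right_slope (is_derive_fisherF N1)).
by apply: near_eq_cvg; near=> h; rewrite !fisherI_dens.
Unshelve. all: by end_near. Qed.

Lemma derive1_fisherI_slope :
  ((fun t => (derive1 (fisherI (ge dens 0)) t - - hessF 0) / t) @ 0^'+ --> dissF 0).
Proof.
have d : is_derive (0 : R) 1 (fun s => - hessF s) (dissF 0).
  by rewrite -[dissF 0]opprK; apply: is_deriveN; exact: is_derive_hessF.
apply: cvg_trans (right_slope d).
by apply: near_eq_cvg; near=> h; rewrite derive1_fisherI.
Unshelve. all: by end_near. Qed.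

Lemma near_Phi_lt0 : fisherF 0 * dissF 0 - hessF 0 ^+ 2 < 0 ->
  exists e : R, 0 < e /\ forall t, 0 < t < e -> fisherF t * dissF t - hessF t ^+ 2 < 0.
Proof.
move=> H.
have cF : {for 0, continuous fisherF}.
  by apply/differentiable_continuous/derivable1_diffP; have [] := is_derive_fisherF N1.
have cH : {for 0, continuous hessF}.
  by apply/differentiable_continuous/derivable1_diffP; have [] := is_derive_hessF N1.
have cD : {for 0, continuous dissF}.
  apply/differentiable_continuous/derivable1_diffP.
  have d : is_derive (0 : R) 1 dissF (int2 (ge (DE VT (Mul dens dissE)) 0)).
    exact: is_derive_int2_ge.
  by have [] := d.
have cP : {for 0, continuous (fun t => fisherF t * dissF t - hessF t ^+ 2)}.
  apply: cvgB; first exact: cvgM.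
  by apply: (continuous_comp (g := fun x => x ^+ 2)) => //; exact: exprn_continuous.
have h : \forall t \near (0 : R), fisherF t * dissF t - hessF t ^+ 2 < 0.
  exact: (cvgr_lt _ cP).
have /nbhs_ballP[e /= e0 he] := h.
exists e; split => // t /andP[t0 te]; apply: he.
by rewrite /ball /= sub0r normrN gtr0_norm.
Qed.

Lemma integrable_ge e t : -1 < t -> integrable2 (ge e t).
Proof. by move=> t1; exact/tame_integrable/tame_ge. Qed.

Lemma dens_properties : int2 (ge dens 0) = 1 ->
  fisherF 0 * dissF 0 - hessF 0 ^+ 2 < 0 -> exists f : fun2 R,
    smooth2 f /\
    (forall x y, 0 < f x y) /\
    (exists C c : R, 0 < c /\
       forall x y, f x y <= C * expR (- c * (x ^+ 2 + y ^+ 2))) /\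
    integrable2 f /\ int2 f = 1 /\
    integrable2 (calI_integrand f) /\
    integrable2 (calQ_integrand f) /\
    integrable2 (calD_integrand f) /\
    calI f * calD f - calQ f ^+ 2 < 0 /\
    (forall t : R, 0 <= t -> integrable2 (fisher_integrand (heat f t))) /\
    (exists d1 d2 : R,
       ((fun h => (fisherI f h - fisherI f 0) / h) @ 0^'+ --> d1) /\
       ((fun t => (derive1 (fisherI f) t - d1) / t) @ 0^'+ --> d2) /\
       fisherI f 0 * d2 - d1 ^+ 2 < 0) /\
    (exists eps : R, 0 < eps /\
       forall t : R, 0 < t < eps ->
         derivable (fisherI f) t 1 /\
         derivable (derive1 (fisherI f)) t 1 /\
         fisherI f t * derive1 (derive1 (fisherI f)) t - (derive1 (fisherI f) t) ^+ 2 < 0).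
Proof.
move=> mass neg; exists (ge dens 0).
split.
- exact: smooth_ge.
split.
- by move=> x y; exact: ge_dens_gt0.
split.
- have [_ _ _ [C [c [c0 h]]]] : tame (ge dens 0) by exact: tame_ge.
  by exists C, c; split => // x y; apply: le_trans (ler_norm _) (h x y).
split.
- exact: integrable_ge.
split.
- by [].
split.
- by rewrite calI_integrandE//; exact: integrable_ge.
split.
- by rewrite calQ_integrandE//; exact: integrable_ge.
split.
- by rewrite calD_integrandE//; exact: integrable_ge.
split.
- by rewrite calI_dens calQ_dens calD_dens.
split.
- move=> t t0; have t1 := lt_le_trans N1 t0.
  by rewrite heat_dens_ge0// fisher_integrandE//; exact: integrable_ge.
split.
- exists (- hessF 0), (dissF 0); split; first exact: fisherI_slope.
  by split; [exact: derive1_fisherI_slope|rewrite fisherI_dens// sqrrN].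
- have [e [e0 he]] := near_Phi_lt0 neg; exists e; split => // t te.
  have /andP[t0 _] := te.
  have [d1 _] := derive_fisherI t0; have [d2 E2] := is_derive_derive1_fisherI t0.
  split => //; split => //.
  by rewrite fisherI_dens ?(ltW t0)// derive1E E2 derive1_fisherI// sqrrN he.
Qed.

End HeatFlow.

(** * Expansion of the densities at t = 0 *)

Section Certificates.
Context {R : realType}.
Variables (L q : R).
Implicit Types (m : atom -> R) (e : @expr R).

Local Notation D := (@deriveE R L q).
Local Notation a := (@scoreE R L q VX).
Local Notation b := (@scoreE R L q VY).

(* At t = 0: phi, its partial derivatives f_I, z = eps / (1 + eps phi), and the partial
   derivatives v_I of log (1 + eps phi). *)
Definition phiv m := 2 * m AC1 ^+ 2 - 1 + 2 * m AC1 * m AC2.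
Definition f1 m := - (4 * m AC1 * m AS1 + 2 * m AS1 * m AC2).
Definition f2 m := - (2 * q * m AC1 * m AS2).
Definition f11 m := - (4 * (m AC1 ^+ 2 - m AS1 ^+ 2) + 2 * m AC1 * m AC2).
Definition f12 m := 2 * q * m AS1 * m AS2.
Definition f22 m := - (6 * m AC1 * m AC2).
Definition f111 m := 16 * m AC1 * m AS1 + 2 * m AS1 * m AC2.
Definition f112 m := 2 * q * m AC1 * m AS2.
Definition f122 m := 6 * m AS1 * m AC2.
Definition f222 m := 6 * q * m AC1 * m AS2.

Definition zv m := m AW * m AS.
Definition v1 m := zv m * f1 m.
Definition v2 m := zv m * f2 m.
Definition v11 m := zv m * f11 m - v1 m * v1 m.
Definition v12 m := zv m * f12 m - v1 m * v2 m.
Definition v22 m := zv m * f22 m - v2 m * v2 m.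
Definition v111 m := zv m * f111 m - 3 * zv m * v1 m * f11 m + 2 * v1 m ^+ 3.
Definition v112 m := zv m * f112 m - zv m * (2 * v1 m * f12 m + v2 m * f11 m)
                     + 2 * v1 m ^+ 2 * v2 m.
Definition v122 m := zv m * f122 m - zv m * (2 * v2 m * f12 m + v1 m * f22 m)
                     + 2 * v1 m * v2 m ^+ 2.
Definition v222 m := zv m * f222 m - 3 * zv m * v2 m * f22 m + 2 * v2 m ^+ 3.

(** All that the expansions need to know of [env] at time 0. The relation [L * m AR = 1] cancels the
    scale factors of the chain rule. *)
Definition initial m := [/\ L * m AR = 1, m AS1 ^+ 2 = 1 - m AC1 ^+ 2,
  m AS2 ^+ 2 = 1 - m AC2 ^+ 2 & m AW * (1 + m AS * phiv m) = 1].

Section AtInitial.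
Variable m : atom -> R.
Hypotheses (q2 : q ^+ 2 = 3) (mi : initial m).

Let Lr : L * m AR = 1. Proof. by have [] := mi. Qed.

Lemma evr_aX : evr m (D VX a) = - m AR + v11 m.
Proof. by rewrite /v11 /v1 /zv /f11 /f1 /=; ring: Lr q2. Qed.

Lemma evr_aY : evr m (D VY a) = v12 m.
Proof. by rewrite /v12 /v1 /v2 /zv /f12 /f1 /f2 /=; ring: Lr q2. Qed.

Lemma evr_bX : evr m (D VX b) = v12 m.
Proof. by rewrite evr_score_sym evr_aY. Qed.

Lemma evr_bY : evr m (D VY b) = - m AR + v22 m.
Proof. by rewrite /v22 /v2 /zv /f22 /f2 /=; ring: Lr q2. Qed.

Lemma evr_aXX : evr m (D VX (D VX a)) = v111 m.
Proof. by rewrite /v111 /v1 /zv /f111 /f11 /f1 /=; ring: Lr q2. Qed.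

Lemma evr_aXY : evr m (D VY (D VX a)) = v112 m.
Proof.
by rewrite /v112 /v2 /v1 /zv /f112 /f12 /f11 /f2 /f1 /=; ring: Lr q2.
Qed.

Lemma evr_aYX : evr m (D VX (D VY a)) = v112 m.
Proof. by rewrite evr_commD evr_aXY. Qed.

Lemma evr_aYY : evr m (D VY (D VY a)) = v122 m.
Proof.
by rewrite /v122 /v2 /v1 /zv /f122 /f12 /f22 /f2 /f1 /=; ring: Lr q2.
Qed.

Lemma evr_bXX : evr m (D VX (D VX b)) = v112 m.
Proof.
by rewrite /v112 /v2 /v1 /zv /f112 /f12 /f11 /f2 /f1 /=; ring: Lr q2.
Qed.

Lemma evr_bYX : evr m (D VX (D VY b)) = v122 m.
Proof.
by rewrite /v122 /v2 /v1 /zv /f122 /f12 /f22 /f2 /f1 /=; ring: Lr q2.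
Qed.

Lemma evr_bXY : evr m (D VY (D VX b)) = v122 m.
Proof. by rewrite evr_commD evr_bYX. Qed.

Lemma evr_bYY : evr m (D VY (D VY b)) = v222 m.
Proof. by rewrite /v222 /v2 /zv /f222 /f22 /f2 /=; ring: Lr q2. Qed.

End AtInitial.

(* (1 + sigma phi) z = sigma, so a power series in z is one in sigma. *)
Lemma expand_z (s f w p0 p1 p2 : R) : w * (1 + s * f) = 1 ->
  (1 + s * f) * (w * s) ^+ 2 * (p0 + p1 * (w * s) + p2 * (w * s) ^+ 2) =
  s ^+ 2 * p0 + s ^+ 3 * (p1 - f * p0) +
  s ^+ 4 * (f ^+ 2 * w * p0 - f * (w + w ^+ 2) * p1 + w ^+ 3 * p2).
Proof.
move=> w1; have d0 : 1 + s * f != 0.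
  by apply: contra_eq_neq w1 => ->; rewrite mulr0 eq_sym oner_eq0.
have -> : w = (1 + s * f)^-1 by apply: (mulIf d0); rewrite w1 mulVf.
by field.
Qed.

(* The list entry (k, i, j) stands for k cos(x)^i cos(q y)^j. *)
Definition trigE (a0 : atom) (l : seq (R * nat * nat)) : @expr R :=
  Mul (At a0) (foldr (fun t => Add (Mul (Cst t.1.1)
    (Mul (iter t.1.2 (Mul (At AC1)) (Cst 1)) (iter t.2 (Mul (At AC2)) (Cst 1))))) (Cst 0) l).

(* p0 minus its mean (certX2) and p1 - phi p0 minus its mean (certX3) are divergences;
   the fluxes come from integrating their Fourier modes, in x whenever possible. *)
Definition certI2 : seq (R * nat * nat) :=
  [:: (16 / 3, 0%N, 1%N); (8, 1%N, 0%N); (- 8, 1%N, 2%N); (- (16 / 3), 2%N, 1%N);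
      (- 4, 3%N, 0%N)].
Definition certI3 : seq (R * nat * nat) :=
  [:: (- (96 / 5), 0%N, 1%N); (40 / 3, 0%N, 3%N); (- 3, 1%N, 0%N); (- 4, 1%N, 2%N);
      (- (88 / 5), 2%N, 1%N); (32 / 3, 2%N, 3%N); (- (34 / 3), 3%N, 0%N);
      (16, 3%N, 2%N); (64 / 5, 4%N, 1%N); (16 / 3, 5%N, 0%N)].
Definition certQ2 : seq (R * nat * nat) :=
  [:: (16 / 3, 0%N, 1%N); (- 20, 1%N, 0%N); (32, 1%N, 2%N); (32 / 3, 2%N, 1%N);
      (16, 3%N, 0%N)].
Definition certQ3 : seq (R * nat * nat) :=
  [:: (128 / 5, 0%N, 1%N); (- 96, 0%N, 3%N); (- 58, 1%N, 0%N); (56, 1%N, 2%N);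
      (864 / 5, 2%N, 1%N); (- 128, 2%N, 3%N); (124, 3%N, 0%N); (- 128, 3%N, 2%N);
      (- (512 / 5), 4%N, 1%N); (- 64, 5%N, 0%N)].
Definition certD2 : seq (R * nat * nat) :=
  [:: (64 / 3, 0%N, 1%N); (104, 1%N, 0%N); (- 128, 1%N, 2%N); (- (64 / 3), 2%N, 1%N);
      (- 64, 3%N, 0%N)].
Definition certD3 : seq (R * nat * nat) :=
  [:: (- (2944 / 5), 0%N, 1%N); (640, 0%N, 3%N); (308, 1%N, 0%N); (- 496, 1%N, 2%N);
      (- (8832 / 5), 2%N, 1%N); (1536, 2%N, 3%N); (- 1272, 3%N, 0%N); (1024, 3%N, 2%N);
      (4096 / 5, 4%N, 1%N); (768, 5%N, 0%N)].

(** Horner form in the amplitude: the lists give the coefficients of its first three powers. *)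
Definition fluxX (l1 l2 l3 : seq (R * nat * nat)) : @expr R :=
  Mul (At AS) (Add (trigE AS1 l1) (Mul (At AS) (Add (trigE AS1 l2)
    (Mul (At AS) (trigE AS1 l3))))).
Definition fluxY (l1 l2 : seq (R * nat * nat)) : @expr R :=
  Mul (At AS) (Add (trigE AS2 l1) (Mul (At AS) (trigE AS2 l2))).

(** The first-order part [- s laplacian phi] of the density of [calI] is the divergence of
    [- s grad phi], encoded by the first lists. The densities of [calQ] and [calD] start at order
    two up to multiples of [1 / L], hence their empty lists. *)
Definition fluxXI := fluxX [:: (4, 1%N, 0%N); (2, 0%N, 1%N)] certI2 certI3.
Definition fluxYI := fluxY [:: (2 * q, 1%N, 0%N)] [:: (- (2 / 3) * q, 0%N, 1%N)].
Definition fluxXQ := fluxX [::] certQ2 certQ3.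
Definition fluxYQ := fluxY [::] [:: (4 / 3 * q, 0%N, 1%N)].
Definition fluxXD := fluxX [::] certD2 certD3.
Definition fluxYD := fluxY [::] [:: (- (8 / 3) * q, 0%N, 1%N)].

Definition div m A B := evr m (D VX A) + evr m (D VY B).

Definition neg_lapE := Neg (Add (D VX a) (D VY b)).
Definition dissipationE := Neg (Add (Mul (Cst 2) (trace3E L q a b)) (Neg (grad2E L q a b))).

(* Each density is z^2 (1 + eps phi) (p0 + p1 z + p2 z^2) up to a divergence and a
   multiple of 1 / L; expand_z turns it into powers of eps with a remainder. *)
Definition p0I m := f1 m ^+ 2 + f2 m ^+ 2.
Definition remI m := phiv m ^+ 2 * m AW * p0I m.

Lemma densityI m : q ^+ 2 = 3 -> initial m ->
  (1 + m AS * phiv m) * evr m neg_lapE =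
  6 * m AS ^+ 2 - 3 * m AS ^+ 3 + div m fluxXI fluxYI +
  m AR * (2 * (1 + m AS * phiv m)) + m AS ^+ 4 * remI m.
Proof.
move=> q2 mi; have [Lr s2 S2 w1] := mi.
have -> : evr m neg_lapE = - (evr m (D VX a) + evr m (D VY b)).
  by rewrite -mulN1r.
rewrite (evr_aX q2 mi) (evr_bY q2 mi).
have E := expand_z (p0I m) 0 0 w1.
(* The Laplacian term is [W (1 + s phi) s laplacian phi = s laplacian phi] exactly; only the squared
   gradient is left to [expand_z]. *)
have -> : (1 + m AS * phiv m) * - (- m AR + v11 m + (- m AR + v22 m)) =
    m AR * (2 * (1 + m AS * phiv m)) - m AS * (f11 m + f22 m) +
    (1 + m AS * phiv m) * (m AW * m AS) ^+ 2 * (p0I m + 0 * (m AW * m AS) + 0 * (m AW * m AS) ^+ 2).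
  rewrite /v11 /v22 /v1 /v2 /zv /p0I.
  transitivity (m AR * (2 * (1 + m AS * phiv m)) -
    (m AW * (1 + m AS * phiv m)) * m AS * (f11 m + f22 m) +
    (1 + m AS * phiv m) * (m AW * m AS) ^+ 2 * (f1 m ^+ 2 + f2 m ^+ 2)); first by ring.
  by rewrite w1; ring.
rewrite E /remI.
have : m AS ^+ 2 * p0I m + m AS ^+ 3 * (0 - phiv m * p0I m) - m AS * (f11 m + f22 m) =
  6 * m AS ^+ 2 - 3 * m AS ^+ 3 + div m fluxXI fluxYI.
  rewrite /div /p0I /phiv /f1 /f2 /f11 /f22 /=.
  by field: Lr q2 s2 S2.
move=> H; rewrite -H; ring.
Qed.

Definition p0Q m := f11 m ^+ 2 + 2 * f12 m ^+ 2 + f22 m ^+ 2.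
Definition p1Q m :=
  - 2 * (f11 m * f1 m ^+ 2 + 2 * f12 m * f1 m * f2 m + f22 m * f2 m ^+ 2).
Definition p2Q m := (f1 m ^+ 2 + f2 m ^+ 2) ^+ 2.
Definition remQ m := phiv m ^+ 2 * m AW * p0Q m - phiv m * (m AW + m AW ^+ 2) * p1Q m
  + m AW ^+ 3 * p2Q m.
(** With [V] the Hessian of [log (1 + eps phi)] and [r = 1 / L], this collects the multiples of [r]
    in [tr (V - r)^2 = tr V^2 + r (2 r - 2 tr V)]. *)
Definition lowQ m := (1 + m AS * phiv m) * (2 * m AR - 2 * (v11 m + v22 m)).

Lemma densityQ m : q ^+ 2 = 3 -> initial m ->
  (1 + m AS * phiv m) * evr m (hess2E L q a b) =
  24 * m AS ^+ 2 - 18 * m AS ^+ 3 + div m fluxXQ fluxYQ + m AR * lowQ m + m AS ^+ 4 * remQ m.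
Proof.
move=> q2 mi; have [Lr s2 S2 w1] := mi.
have -> : evr m (hess2E L q a b) = evr m (D VX a) * evr m (D VX a) +
  evr m (D VX b) * evr m (D VY a) + (evr m (D VY a) * evr m (D VX b) +
  evr m (D VY b) * evr m (D VY b)) by [].
rewrite (evr_aX q2 mi) (evr_bY q2 mi) (evr_aY q2 mi) (evr_bX q2 mi).
have E := expand_z (p0Q m) (p1Q m) (p2Q m) w1.
transitivity (m AR * lowQ m + (1 + m AS * phiv m) * (m AW * m AS) ^+ 2 *
    (p0Q m + p1Q m * (m AW * m AS) + p2Q m * (m AW * m AS) ^+ 2)).
  rewrite /lowQ /v11 /v22 /v12 /v1 /v2 /zv /p0Q /p1Q /p2Q.
  move: (phiv m) (f1 m) (f2 m) (f11 m) (f12 m) (f22 m) => *; ring.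
rewrite E -/(remQ m).
have H : m AS ^+ 2 * p0Q m + m AS ^+ 3 * (p1Q m - phiv m * p0Q m) =
  24 * m AS ^+ 2 - 18 * m AS ^+ 3 + div m fluxXQ fluxYQ.
  rewrite /div /p0Q /p1Q /phiv /f1 /f2 /f11 /f12 /f22 /=.
  by field: Lr q2 s2 S2.
by rewrite H; ring.
Qed.

(* v_ijk = z f_ijk - z^2 g_ijk + 2 z^3 f_i f_j f_k; trf3, qf1, qf2 and n2 are the traces of
   F^3, F N, F^2 N and N, with F the Hessian of phi and N = grad phi (grad phi)^T. *)
Definition g111 m := 3 * f1 m * f11 m.
Definition g112 m := 2 * f1 m * f12 m + f2 m * f11 m.
Definition g122 m := 2 * f2 m * f12 m + f1 m * f22 m.
Definition g222 m := 3 * f2 m * f22 m.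
Definition trf3 m := f11 m ^+ 3 + 3 * f11 m * f12 m ^+ 2 + 3 * f12 m ^+ 2 * f22 m + f22 m ^+ 3.
Definition qf1 m := f11 m * f1 m ^+ 2 + 2 * f12 m * f1 m * f2 m + f22 m * f2 m ^+ 2.
Definition qf2 m := (f11 m * f1 m + f12 m * f2 m) ^+ 2 + (f12 m * f1 m + f22 m * f2 m) ^+ 2.
Definition n2 m := f1 m ^+ 2 + f2 m ^+ 2.

Definition p0D m := f111 m ^+ 2 + 3 * f112 m ^+ 2 + 3 * f122 m ^+ 2 + f222 m ^+ 2.
Definition p1D m := - 2 * (f111 m * g111 m + 3 * f112 m * g112 m + 3 * f122 m * g122 m
  + f222 m * g222 m) - 2 * trf3 m.
(** The fifth and sixth powers of [z] are folded in by letting this coefficient depend on [z]; it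
    enters only the remainder [remD], where boundedness is enough. *)
Definition p2D m :=
  g111 m ^+ 2 + 3 * g112 m ^+ 2 + 3 * g122 m ^+ 2 + g222 m ^+ 2 +
  4 * (f111 m * f1 m ^+ 3 + 3 * f112 m * f1 m ^+ 2 * f2 m +
       3 * f122 m * f1 m * f2 m ^+ 2 + f222 m * f2 m ^+ 3) + 6 * qf2 m
  - zv m * (4 * (g111 m * f1 m ^+ 3 + 3 * g112 m * f1 m ^+ 2 * f2 m +
       3 * g122 m * f1 m * f2 m ^+ 2 + g222 m * f2 m ^+ 3) + 6 * n2 m * qf1 m)
  + zv m ^+ 2 * (6 * n2 m ^+ 3).
Definition remD m := phiv m ^+ 2 * m AW * p0D m - phiv m * (m AW + m AW ^+ 2) * p1D m
  + m AW ^+ 3 * p2D m.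
(** Multiples of [r] in [2 tr (r - V)^3]; the remaining part [- 2 tr V^3] goes into [p1D] and
    [p2D]. *)
Definition lowD m := (1 + m AS * phiv m) *
  (6 * (v11 m ^+ 2 + 2 * v12 m ^+ 2 + v22 m ^+ 2) - 6 * m AR * (v11 m + v22 m) + 4 * m AR ^+ 2).

Lemma densityD m : q ^+ 2 = 3 -> initial m ->
  (1 + m AS * phiv m) * evr m dissipationE =
  96 * m AS ^+ 2 - 108 * m AS ^+ 3 + div m fluxXD fluxYD + m AR * lowD m + m AS ^+ 4 * remD m.
Proof.
move=> q2 mi; have [Lr s2 S2 w1] := mi.
have -> : evr m dissipationE = - 1 * (2 * evr m (trace3E L q a b) + - 1 * evr m (grad2E L q a b)) by [].
have -> : evr m (trace3E L q a b) =
  let aX := evr m (D VX a) in let aY := evr m (D VY a) in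
  let bX := evr m (D VX b) in let bY := evr m (D VY b) in
  aX * aX * aX + aX * bX * aY + (bX * aY * aX + bX * bY * aY) +
  (aY * aX * bX + aY * bX * bY + (bY * aY * bX + bY * bY * bY)) by [].
have -> : evr m (grad2E L q a b) =
  evr m (D VX (D VX a)) ^+ 2 + evr m (D VY (D VX a)) ^+ 2 +
  (evr m (D VX (D VX b)) ^+ 2 + evr m (D VY (D VX b)) ^+ 2) +
  (evr m (D VX (D VY a)) ^+ 2 + evr m (D VY (D VY a)) ^+ 2 +
  (evr m (D VX (D VY b)) ^+ 2 + evr m (D VY (D VY b)) ^+ 2)) by rewrite !expr2.
rewrite (evr_aXX q2 mi) (evr_aXY q2 mi) (evr_aYX q2 mi) (evr_aYY q2 mi).
rewrite (evr_bXX q2 mi) (evr_bXY q2 mi) (evr_bYX q2 mi) (evr_bYY q2 mi).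
rewrite (evr_aX q2 mi) (evr_bY q2 mi) (evr_aY q2 mi) (evr_bX q2 mi).
have E := expand_z (p0D m) (p1D m) (p2D m) w1.
transitivity (m AR * lowD m + (1 + m AS * phiv m) * (m AW * m AS) ^+ 2 *
    (p0D m + p1D m * (m AW * m AS) + p2D m * (m AW * m AS) ^+ 2)).
  rewrite /lowD /p0D /p1D /p2D /g111 /g112 /g122 /g222 /trf3 /qf1 /qf2 /n2.
  rewrite /v111 /v112 /v122 /v222 /v11 /v22 /v12 /v1 /v2 /zv /=.
  move: (phiv m) (f1 m) (f2 m) (f11 m) (f12 m) (f22 m) (f111 m) (f112 m) (f122 m) (f222 m) => *.
  ring.
rewrite E -/(remD m).
have H : m AS ^+ 2 * p0D m + m AS ^+ 3 * (p1D m - phiv m * p0D m) =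
  96 * m AS ^+ 2 - 108 * m AS ^+ 3 + div m fluxXD fluxYD.
  rewrite /div /p0D /p1D /g111 /g112 /g122 /g222 /trf3 /phiv.
  rewrite /f1 /f2 /f11 /f12 /f22 /f111 /f112 /f122 /f222 /=.
  by field: Lr q2 s2 S2.
by rewrite H; ring.
Qed.

(** [AX] and [AY] are left free: the fluxes and remainders contain no bare coordinates. *)
Definition admissible m := [/\ `|m AR| <= 1, `|m AS| <= 1, `|m AW| <= 2 &
  [/\ `|m AC1| <= 1, `|m AS1| <= 1, `|m AC2| <= 1 & `|m AS2| <= 1]].

(** Amplitude and precision enter as atoms, so a bound uniform over admissible assignments involves
    neither [eps] nor [L]. This is what lets [eps] be chosen after the constants. *)
Definition bdd (F : (atom -> R) -> R) :=
  exists K : R, 0 <= K /\ forall m, admissible m -> `|F m| <= K.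

Lemma bdd_cst (k : R) : bdd (fun=> k).
Proof. by exists `|k|. Qed.

Lemma bddD F G : bdd F -> bdd G -> bdd (fun m => F m + G m).
Proof.
move=> [K [K0 hK]] [M [M0 hM]]; exists (K + M); split; first exact: addr_ge0.
by move=> m am; rewrite (le_trans (ler_normD _ _))// lerD ?hK ?hM.
Qed.

Lemma bddM F G : bdd F -> bdd G -> bdd (fun m => F m * G m).
Proof.
move=> [K [K0 hK]] [M [M0 hM]]; exists (K * M); split; first exact: mulr_ge0.
by move=> m am; rewrite normrM ler_pM ?hK ?hM.
Qed.

Lemma bddN F : bdd F -> bdd (fun m => - F m).
Proof.
move=> [K [K0 hK]]; exists K; split => // m am.
by rewrite normrN hK.
Qed.

Lemma bddX F k : bdd F -> bdd (fun m => F m ^+ k).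
Proof.
move=> bF; elim: k => [|k IH]; first exact: bdd_cst.
by under eq_fun do rewrite exprS; exact: bddM.
Qed.

Lemma bdd_atom a0 : a0 <> AX -> a0 <> AY -> bdd (fun m => m a0).
Proof.
move=> nX nY; exists 2; split => // m [hR hS hW [h1 h2 h3 h4]].
have l12 : 1 <= 2 :> R by rewrite ler1n.
by case: a0 nX nY => // _ _; try exact: hW; apply: le_trans l12.
Qed.

Ltac bound_polynomial :=
  repeat first [ assumption | apply: bddD | apply: bddN | apply: bddX | apply: bddM
               | exact: bdd_cst | by apply: bdd_atom ].

Lemma bdd_remI : bdd remI.
Proof.
rewrite /remI /p0I /phiv /f1 /f2; bound_polynomial.
Qed.

Lemma bdd_lowI : bdd (fun m => 2 * (1 + m AS * phiv m)).
Proof. by rewrite /phiv; bound_polynomial. Qed.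

Lemma bdd_remQ : bdd remQ.
Proof.
rewrite /remQ /p0Q /p1Q /p2Q /phiv /f1 /f2 /f11 /f12 /f22; bound_polynomial.
Qed.

Lemma bdd_lowQ : bdd lowQ.
Proof.
rewrite /lowQ /v11 /v22 /v1 /v2 /zv /phiv /f1 /f2 /f11 /f22; bound_polynomial.
Qed.

Lemma bdd_remD : bdd remD.
Proof.
have b1 : bdd f1 by rewrite /f1; bound_polynomial.
have b2 : bdd f2 by rewrite /f2; bound_polynomial.
have b11 : bdd f11 by rewrite /f11; bound_polynomial.
have b12 : bdd f12 by rewrite /f12; bound_polynomial.
have b22 : bdd f22 by rewrite /f22; bound_polynomial.
have b111 : bdd f111 by rewrite /f111; bound_polynomial.
have b112 : bdd f112 by rewrite /f112; bound_polynomial.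
have b122 : bdd f122 by rewrite /f122; bound_polynomial.
have b222 : bdd f222 by rewrite /f222; bound_polynomial.
have c111 : bdd g111 by rewrite /g111; bound_polynomial.
have c112 : bdd g112 by rewrite /g112; bound_polynomial.
have c122 : bdd g122 by rewrite /g122; bound_polynomial.
have c222 : bdd g222 by rewrite /g222; bound_polynomial.
rewrite /remD /p0D /p1D /p2D /trf3 /qf1 /qf2 /n2 /zv /phiv; bound_polynomial.
Qed.

Lemma bdd_lowD : bdd lowD.
Proof.
rewrite /lowD /v11 /v12 /v22 /v1 /v2 /zv /phiv /f1 /f2 /f11 /f12 /f22; bound_polynomial.
Qed.

Lemma bdd_trigE a0 l : a0 <> AX -> a0 <> AY -> bdd (fun m => evr m (trigE a0 l)).
Proof.
have bi a1 k : a1 <> AX -> a1 <> AY -> bdd (fun m => evr m (iter k (Mul (At a1)) (Cst 1))).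
  move=> aX aY; elim: k => [|k IH] /=; first exact: bdd_cst.
  by apply: bddM => //; exact: bdd_atom.
move=> aX aY; apply: bddM; first exact: bdd_atom.
elim: l => [|t l IH] /=; first exact: bdd_cst.
apply: bddD => //; apply: bddM; first exact: bdd_cst.
by apply: bddM; exact: bi.
Qed.

Lemma bdd_fluxX l1 l2 l3 : bdd (fun m => evr m (fluxX l1 l2 l3)).
Proof.
have bS : bdd (fun m => m AS) by exact: bdd_atom.
apply: bddM => //; apply: bddD; first exact: bdd_trigE.
apply: bddM => //; apply: bddD; first exact: bdd_trigE.
by apply: bddM => //; exact: bdd_trigE.
Qed.

Lemma bdd_fluxY l1 l2 : bdd (fun m => evr m (fluxY l1 l2)).
Proof.
have bS : bdd (fun m => m AS) by exact: bdd_atom.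
apply: bddM => //; apply: bddD; first exact: bdd_trigE.
by apply: bddM => //; exact: bdd_trigE.
Qed.

Lemma bdd4 (F1 F2 F3 F4 : (atom -> R) -> R) : bdd F1 -> bdd F2 -> bdd F3 -> bdd F4 ->
  exists K : R, 0 < K /\ forall m, admissible m ->
    [/\ `|F1 m| <= K, `|F2 m| <= K, `|F3 m| <= K & `|F4 m| <= K].
Proof.
move=> [k1 [p1 h1]] [k2 [p2 h2]] [k3 [p3 h3]] [k4 [p4 h4]].
exists (1 + (k1 + k2 + k3 + k4)); split; first by lra.
move=> m am; split.
- by apply: (le_trans (h1 m am)); lra.
- by apply: (le_trans (h2 m am)); lra.
- by apply: (le_trans (h3 m am)); lra.
- by apply: (le_trans (h4 m am)); lra.
Qed.

End Certificates.

(** * Averages against the wide Gaussian *)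

Section Averages.
Context {R : realType}.
Variables (L eps q dl : R).
Hypotheses (L2 : 2 <= L) (eps0 : 0 < eps) (eps1 : eps <= expR (- 4) / 6).
Hypotheses (q2 : q ^+ 2 = 3) (dl0 : 0 < dl) (dlL : dl ^+ 2 = L^-1).
Implicit Types (e A B X : @expr R) (x y : R).

Local Notation D := (@deriveE R L q).
Local Notation DE := (@gderiveE R L q).
Local Notation ev := (@evalE R L eps q).
Local Notation ge := (@gevalE R L eps q).

Let N1 : -1 < 0 :> R. Proof. by rewrite ltrN10. Qed.
Let Lgt0 : 0 < L. Proof. by apply: lt_le_trans L2. Qed.
Let rr0 : precision L 0 = L^-1. Proof. by rewrite /precision addr0. Qed.

Definition mass0 := int2 (ge (Cst 1) 0).

Lemma igE e : integrable2 (ge e 0).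
Proof. exact: integrable_ge. Qed.

Lemma mass0_gt0 : 0 < mass0.
Proof.
rewrite /mass0 (_ : ge (Cst 1) 0 = gsq (L^-1 / 2)).
  by rewrite int2_gsq ?divr_gt0 ?pi_gt0 ?invr_gt0.
by apply/funext => x; apply/funext => y; rewrite /gevalE rr0 mulr1.
Qed.

Lemma initial_env x y : initial L (env L eps q 0 x y).
Proof.
have p x' : sin x' ^+ 2 = 1 - cos x' ^+ 2 :> R by rewrite sin2cos2.
split => //=; first by rewrite rr0 mulfV// gt_eqF.
have -> : phiv (env L eps q 0 x y) = profile L q 0 x y by rewrite /phiv /profile /=.
by rewrite mulVf// gt_eqF// den_gt0.
Qed.

Lemma admissible_env x y : admissible (env L eps q 0 x y).
Proof.
split; last by split; rewrite ?norm_cos ?norm_sin.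
- by rewrite ger0_norm ?(ltW (precision_gt0 _ _))//; apply: precision_le1.
- rewrite ger0_norm ?(ltW (amplitude_gt0 _ _ _))//=.
  by apply: le_trans (amplitude_le _ _ _ _) _ => //; rewrite invf_le1 ?ler1n.
- have h : 0 < 1 + amplitude L eps 0 * profile L q 0 x y by exact: den_gt0.
  rewrite ger0_norm ?invr_ge0 ?(ltW h)//.
  by rewrite -[leRHS]invrK lef_pV2 ?posrE ?invr_gt0// den_ge.
Qed.

Lemma int2_ge_add e1 e2 : int2 (ge (Add e1 e2) 0) = int2 (ge e1 0) + int2 (ge e2 0).
Proof.
rewrite -int2D; [|exact: igE|exact: igE]; congr int2.
by apply/funext => x; apply/funext => y; rewrite ge_add.
Qed.

Lemma int2_second_moment1 : int2 (ge (Mul (Cst L^-1) (Mul (At AX) (At AX))) 0) = mass0.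
Proof.
have h : int2 (ge (DE VX (At AX)) 0) = 0 by exact: int2_geX.
have E : ge (DE VX (At AX)) 0 =
    fun x y => ge (Cst 1) 0 x y + - 1 * ge (Mul (Cst L^-1) (Mul (At AX) (At AX))) 0 x y.
  by apply/funext => x; apply/funext => y; rewrite /gevalE /evalE /= rr0; ring.
move: h; rewrite E int2D; [|exact: igE|exact/integrable2Z/igE].
by rewrite int2Z; [|exact: igE]; move=> /eqP; rewrite mulN1r subr_eq0 => /eqP.
Qed.

Lemma int2_second_moment2 : int2 (ge (Mul (Cst L^-1) (Mul (At AY) (At AY))) 0) = mass0.
Proof.
have h : int2 (ge (DE VY (At AY)) 0) = 0 by exact: int2_geY.
have E : ge (DE VY (At AY)) 0 =
    fun x y => ge (Cst 1) 0 x y + - 1 * ge (Mul (Cst L^-1) (Mul (At AY) (At AY))) 0 x y.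
  by apply/funext => x; apply/funext => y; rewrite /gevalE /evalE /= rr0; ring.
move: h; rewrite E int2D; [|exact: igE|exact/integrable2Z/igE].
by rewrite int2Z; [|exact: igE]; move=> /eqP; rewrite mulN1r subr_eq0 => /eqP.
Qed.

Lemma normr_int2_ge_le e1 e2 : (forall x y, `|ev e1 0 x y| <= ev e2 0 x y) ->
  `|int2 (ge e1 0)| <= int2 (ge e2 0).
Proof.
move=> h; apply: normr_int2_le; [exact: igE|exact: igE|] => x y.
by rewrite normrM (ger0_norm (gsq_ge0 _ _ _)) ler_wpM2l ?gsq_ge0.
Qed.

Lemma int2_ge_scale k e : int2 (ge (Mul (Cst k) e) 0) = k * int2 (ge e 0).
Proof.
rewrite -int2Z; last exact: igE; congr int2.
by apply/funext => x; apply/funext => y; rewrite /gevalE /evalE /=; ring.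
Qed.

(** The difference is a multiple of [(1 - dl |x|)^2]. In place of Cauchy-Schwarz, this bounds the
    first absolute moment by the second, which is known exactly. *)
Let amgm x : `|x * L^-1| <= dl / 2 * (1 + L^-1 * (x * x)).
Proof.
rewrite -dlL normrM (ger0_norm (sqr_ge0 dl)).
have h : `|x| ^+ 2 = x * x by rewrite -expr2; exact: real_normK (num_real x).
rewrite -h; have := normr_ge0 x; move: (`|x|) => u u0.
rewrite -subr_ge0 (_ : _ - _ = dl / 2 * (1 - dl * u) ^+ 2); last by field.
by rewrite mulr_ge0 ?sqr_ge0// divr_ge0// ltW.
Qed.

(* Integration by parts moves the derivative onto the Gaussian, of width L^(1/2) = 1/dl. *)
Lemma int2_dX_small A K : 0 <= K -> (forall x y, `|ev A 0 x y| <= K) ->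
  `|int2 (ge (D VX A) 0)| <= K * dl * mass0.
Proof.
move=> K0 hA.
have h : int2 (ge (DE VX A) 0) = 0 by exact: int2_geX.
have : int2 (ge (D VX A) 0) = - int2 (ge (Mul (logE VX) A) 0).
  by move: h; rewrite int2_ge_add => /eqP; rewrite addr_eq0 => /eqP.
move=> ->; rewrite normrN.
pose e2 := Mul (Cst (K * dl / 2)) (Add (Cst 1) (Mul (Cst L^-1) (Mul (At AX) (At AX)))).
apply: (@le_trans _ _ (int2 (ge e2 0))).
  apply: normr_int2_ge_le => x y.
  rewrite /evalE /= rr0 -/(evalE _ _ _ _ _ _ _) normrM mulN1r normrN.
  have -> : K * dl / 2 * (1 + L^-1 * (x * x)) = dl / 2 * (1 + L^-1 * (x * x)) * K by ring.
  by rewrite ler_pM ?normr_ge0 ?amgm.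
rewrite /e2 int2_ge_scale int2_ge_add int2_second_moment1 -/mass0.
by rewrite [X in X <= _](_ : _ = K * dl * mass0)//; field.
Qed.

Lemma int2_dY_small A K : 0 <= K -> (forall x y, `|ev A 0 x y| <= K) ->
  `|int2 (ge (D VY A) 0)| <= K * dl * mass0.
Proof.
move=> K0 hA.
have h : int2 (ge (DE VY A) 0) = 0 by exact: int2_geY.
have : int2 (ge (D VY A) 0) = - int2 (ge (Mul (logE VY) A) 0).
  by move: h; rewrite int2_ge_add => /eqP; rewrite addr_eq0 => /eqP.
move=> ->; rewrite normrN.
pose e2 := Mul (Cst (K * dl / 2)) (Add (Cst 1) (Mul (Cst L^-1) (Mul (At AY) (At AY)))).
apply: (@le_trans _ _ (int2 (ge e2 0))).
  apply: normr_int2_ge_le => x y.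
  rewrite /evalE /= rr0 -/(evalE _ _ _ _ _ _ _) normrM mulN1r normrN.
  have -> : K * dl / 2 * (1 + L^-1 * (y * y)) = dl / 2 * (1 + L^-1 * (y * y)) * K by ring.
  by rewrite ler_pM ?normr_ge0 ?amgm.
rewrite /e2 int2_ge_scale int2_ge_add int2_second_moment2 -/mass0.
by rewrite [X in X <= _](_ : _ = K * dl * mass0)//; field.
Qed.

Lemma int2_ge_cst k : int2 (ge (Cst k) 0) = k * mass0.
Proof.
rewrite -int2_ge_scale; congr int2.
by apply/funext => x; apply/funext => y; rewrite /gevalE /evalE /= mulr1.
Qed.

(** The cost of each term: [dl] for each of the two flux derivatives, [1 / L] for the contribution
    of the wide Gaussian's own Hessian, [eps^4] for the remainder of the expansion. *)
Lemma density_estimate X A B (n k K : R) (low rem : (atom -> R) -> R) :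
  0 <= n -> 0 <= K ->
  (forall m, initial L m -> m AS = eps -> (1 + m AS * phiv m) * evr m X =
     k + div L q m A B + m AR * low m + m AS ^+ 4 * rem m) ->
  (forall m, admissible m ->
     [/\ `|evr m A| <= K, `|evr m B| <= K, `|low m| <= K & `|rem m| <= K]) ->
  `|int2 (ge (Mul (densE n) X) 0) - n * L^-1 * mass0 * k| <=
  n * L^-1 * mass0 * (K * (2 * dl + L^-1 + eps ^+ 4)).
Proof.
move=> n0 K0 hX hb; have M0 := mass0_gt0; have Li : 0 < L^-1 by rewrite invr_gt0.
have sgE : amplitude L eps 0 = eps by rewrite /amplitude rr0 mulfV ?subrr ?mulr0 ?expR0 ?mulr1// gt_eqF.
pose Xh := Mul (Add (Cst 1) (@sphiE R)) X.
pose Rem := Add Xh (Neg (Add (Cst k) (Add (D VX A) (D VY B)))).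
have EX : int2 (ge (Mul (densE n) X) 0) = n * L^-1 * int2 (ge Xh 0).
  rewrite -int2_ge_scale; congr int2; apply/funext => x; apply/funext => y.
  rewrite /gevalE; congr (_ * _).
  have -> : ev (Mul (densE n) X) 0 x y = n * precision L 0 * ev (Add (Cst 1) (@sphiE R)) 0 x y * ev X 0 x y by [].
  by rewrite rr0 /Xh !ev_mul ev_cst mulrA.
have ES : int2 (ge Xh 0) = k * mass0 + (int2 (ge (D VX A) 0) + int2 (ge (D VY B) 0)) + int2 (ge Rem 0).
  rewrite -int2_ge_cst -!int2_ge_add; congr int2; apply/funext => x; apply/funext => y.
  rewrite /gevalE; congr (_ * _); rewrite /Rem /Neg.
  rewrite [RHS](_ : _ = k + (ev (D VX A) 0 x y + ev (D VY B) 0 x y) + (ev Xh 0 x y +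
    - 1 * (k + (ev (D VX A) 0 x y + ev (D VY B) 0 x y))))//.
  by ring.
have hA x y : `|ev A 0 x y| <= K by have [] := hb _ (admissible_env x y).
have hB x y : `|ev B 0 x y| <= K by have [] := hb _ (admissible_env x y).
have dA := int2_dX_small K0 hA; have dB := int2_dY_small K0 hB.
have dR : `|int2 (ge Rem 0)| <= K * (L^-1 + eps ^+ 4) * mass0.
  rewrite -int2_ge_cst; apply: normr_int2_ge_le => x y.
  set m := env L eps q 0 x y.
  have mS : m AS = eps by rewrite /m /= sgE.
  have mR : m AR = L^-1 by rewrite /m /= rr0.
  have -> : ev Rem 0 x y = m AR * low m + m AS ^+ 4 * rem m.
    have -> : ev Rem 0 x y = (1 + evr m (@sphiE R)) * evr m X + - 1 * (k + div L q m A B) by [].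
    have -> : evr m (@sphiE R) = m AS * phiv m by rewrite /phiv /=; ring.
    by rewrite hX ?mS//; [ring|exact: initial_env].
  rewrite mS mR ev_cst (le_trans (ler_normD _ _))//.
  have [_ _ hl hr] := hb _ (admissible_env x y).
  rewrite [`|L^-1 * _|]normrM [`|eps ^+ 4 * _|]normrM normrX.
  rewrite (ger0_norm (ltW Li)) (gtr0_norm eps0) mulrDr.
  by rewrite lerD// mulrC ler_wpM2r ?exprn_ge0// ltW.
have nL : 0 <= n * L^-1 by rewrite mulr_ge0// ltW.
rewrite EX ES (_ : _ - _ = n * L^-1 * (int2 (ge (D VX A) 0) + int2 (ge (D VY B) 0) + int2 (ge Rem 0))); last by ring.
rewrite normrM (ger0_norm nL) -mulrA ler_wpM2l//.
rewrite (_ : mass0 * _ = K * dl * mass0 + K * dl * mass0 + K * (L^-1 + eps ^+ 4) * mass0); last by ring.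
by rewrite (le_trans (ler_normD _ _))// lerD// (le_trans (ler_normD _ _))// lerD.
Qed.

End Averages.

(** * Sign of the leading term and choice of the parameters *)

(** Since [6 * 96 = 24^2] and [3 * 108 = 18^2], the main terms leave only [(- 6 * 108 - 3 * 96 + 2 *
    24 * 18) e^5 = - 72 e^5]. Errors of at most [e^3 / 100] raise this by at most
    [1.5 e^5 + 3 e^6]. *)
Lemma leading_terms_lt0 (R : realType) (e i k d : R) : 0 < e -> e <= 100^-1 ->
  `|i| <= e ^+ 3 / 100 -> `|k| <= e ^+ 3 / 100 -> `|d| <= e ^+ 3 / 100 ->
  (6 * e ^+ 2 - 3 * e ^+ 3 + i) * (96 * e ^+ 2 - 108 * e ^+ 3 + d) -
  (24 * e ^+ 2 - 18 * e ^+ 3 + k) ^+ 2 < 0.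
Proof.
move=> e0 e1 hi hk hd; have e3 : 0 < e ^+ 3 by rewrite exprn_gt0.
have H (z : R) : `|z| <= e ^+ 3 / 100 -> exists2 u, z = e ^+ 3 * u & `|u| <= 100^-1.
  move=> hz; exists (z / e ^+ 3); first by rewrite mulrC mulfVK// gt_eqF.
  by rewrite normrM normfV (gtr0_norm e3) ler_pdivrMr// mulrC.
have [u -> hu] := H _ hi; have [w -> hw] := H _ hk; have [v -> hv] := H _ hd.
rewrite [ltLHS](_ : _ = e ^+ 5 * (- 72 + 96 * u + 6 * v - 48 * w +
  e * (u * v - 108 * u - 3 * v + 36 * w - w ^+ 2))); last by ring.
rewrite pmulr_rlt0 ?exprn_gt0//.
have uv : u * v <= 1.
  have l1 : 100^-1 <= 1 :> R by rewrite invf_le1 ?ler1n.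
  rewrite (le_trans (ler_norm _))// normrM mulr_ile1 ?normr_ge0//.
  - exact: le_trans l1.
  - exact: le_trans l1.
move: hu hv hw; rewrite !ler_norml => /andP[u1 u2] /andP[v1 v2] /andP[w1 w2].
have br : u * v - 108 * u - 3 * v + 36 * w - w ^+ 2 <= 3.
  by have := sqr_ge0 w; lra.
have : e * (u * v - 108 * u - 3 * v + 36 * w - w ^+ 2) <= e * 3 by rewrite ler_pM2l.
by lra.
Qed.

Theorem theorem1p1 (R : realType) :
  exists f : fun2 R,
    (* smooth, strictly positive, Gaussian-decaying probability density *)
    smooth2 f /\
    (forall x y, 0 < f x y) /\
    (exists C c : R, 0 < c /\
       forall x y, f x y <= C * expR (- c * (x ^+ 2 + y ^+ 2))) /\
    integrable2 f /\ int2 f = 1 /\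
    (* the functionals are finite *)
    integrable2 (calI_integrand f) /\
    integrable2 (calQ_integrand f) /\
    integrable2 (calD_integrand f) /\
    (* main inequality *)
    calI f * calD f - calQ f ^+ 2 < 0 /\
    (* Fisher information along the heat flow is finite *)
    (forall t : R, 0 <= t -> integrable2 (fisher_integrand (heat f t))) /\
    (* Phi_f(0) < 0, with I'(0), I''(0) one-sided (right) derivatives at 0 *)
    (exists d1 d2 : R,
       ((fun h => (fisherI f h - fisherI f 0) / h) @ 0^'+ --> d1) /\
       ((fun t => (derive1 (fisherI f) t - d1) / t) @ 0^'+ --> d2) /\
       fisherI f 0 * d2 - d1 ^+ 2 < 0) /\
    (* Phi_f(t) < 0 for all sufficiently small t > 0 *)
    (exists eps : R, 0 < eps /\
       forall t : R, 0 < t < eps ->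
         derivable (fisherI f) t 1 /\
         derivable (derive1 (fisherI f)) t 1 /\
         fisherI f t * derive1 (derive1 (fisherI f)) t - (derive1 (fisherI f) t) ^+ 2 < 0).
Proof.
pose q : R := Num.sqrt 3.
have q2 : q ^+ 2 = 3 by rewrite sqr_sqrtr.
have [KI [KI0 hI]] := bdd4 (F1 := fun m : atom -> R => evr m fluxXI) (F2 := fun m => evr m (fluxYI q))
  (bdd_fluxX _ _ _) (bdd_fluxY _ _) bdd_lowI (bdd_remI q).
have [KQ [KQ0 hQ]] := bdd4 (F1 := fun m : atom -> R => evr m fluxXQ) (F2 := fun m => evr m (fluxYQ q))
  (bdd_fluxX _ _ _) (bdd_fluxY _ _) (bdd_lowQ q) (bdd_remQ q).
have [KD [KD0 hD]] := bdd4 (F1 := fun m : atom -> R => evr m fluxXD) (F2 := fun m => evr m (fluxYD q))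
  (bdd_fluxX _ _ _) (bdd_fluxY _ _) (bdd_lowD q) (bdd_remD q).
pose K := 1 + KI + KQ + KD.
have K1 : 1 <= K by rewrite /K; lra.
have K0 : 0 < K by apply: lt_le_trans K1.
(* The 100 is the tolerance of [leading_terms_lt0], the 4 comes from [2 dl + 1 / L + eps^4 <= 4 dl],
   and [expR (- 4)] yields the positivity bound [eps1]. *)
pose eps : R := expR (- 4) / (100 * (4 * K)).
have E1 : expR (- 4) <= 1 :> R by rewrite -[leRHS]expR0 ler_expR oppr_le0.
have eps0 : 0 < eps by rewrite divr_gt0 ?expR_gt0// !mulr_gt0.
have epsK : eps * (100 * (4 * K)) = expR (- 4).
  by rewrite /eps mulfVK// gt_eqF// !mulr_gt0.
have eps1 : eps <= expR (- 4) / 6 by rewrite -epsK; nra.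
have epsd : eps <= 100^-1.
  by rewrite -[leRHS]mul1r ler_pdivlMr//; nra.
pose dl := eps ^+ 4; have dl0 : 0 < dl by rewrite exprn_gt0.
have dl1 : dl <= 2^-1.
  have e1 : eps <= 1 by lra.
  have : eps ^+ 3 <= 1 by rewrite exprn_ile1// ltW.
  by rewrite /dl exprS => h; nra.
pose L := (dl ^+ 2)^-1.
have dlL : dl ^+ 2 = L^-1 by rewrite invrK.
have Ld : L^-1 <= dl by rewrite -dlL; nra.
have L2 : 2 <= L by rewrite -[2]invrK lef_pV2 ?posrE ?invr_gt0 ?exprn_gt0//; nra.
pose n : R := (int2 (gevalE L eps q (densE 1) 0))^-1.
have N1 : -1 < 0 :> R by rewrite ltrN10.
have M0 : 0 < mass0 L eps q by exact: mass0_gt0.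
have m1 : 0 < int2 (gevalE L eps q (densE 1) 0).
  apply: (@lt_le_trans _ _ (L^-1 / 2 * mass0 L eps q)).
    by rewrite mulr_gt0// divr_gt0// invr_gt0; apply: lt_le_trans L2.
  rewrite -int2_ge_cst//; apply: le_int2; [exact: integrable_ge|exact: integrable_ge|].
  move=> x y; rewrite ge_densE /gevalE ler_wpM2l ?gsq_ge0// ev_cst mul1r /precision addr0.
  by rewrite ler_wpM2l ?den_ge// invr_ge0; apply: le_trans L2.
have n0 : 0 < n by rewrite invr_gt0.
have mass : int2 (gevalE L eps q (densE n) 0) = 1.
  rewrite -(mulVf (lt0r_neq0 m1)) -/n -int2Z; last exact: integrable_ge.
  congr int2; apply/funext => x; apply/funext => y.
  by rewrite !ge_densE; ring.
apply: (@dens_properties R L eps q n) => //.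
(* Common factor of the three functionals. The inequality is homogeneous of degree two, so only its
   positivity matters. *)
pose mu := n * L^-1 * mass0 L eps q.
have mu0 : 0 < mu by rewrite !mulr_gt0// invr_gt0; apply: lt_le_trans L2.
have err k : k <= K -> k * (2 * dl + L^-1 + eps ^+ 4) <= eps ^+ 3 / 100.
  move=> kK; have d0 : 0 <= 2 * dl + L^-1 + eps ^+ 4.
    have Li : 0 < L^-1 by rewrite -dlL exprn_gt0.
    by rewrite -/dl; lra.
  apply: (@le_trans _ _ (K * (4 * dl))).
    apply: (le_trans (ler_wpM2r d0 kK)).
    by rewrite ler_wpM2l ?(ltW K0)// -/dl; lra.
  rewrite ler_pdivlMr// /dl exprS (_ : _ * 100 = eps * (100 * (4 * K)) * eps ^+ 3); last by ring.
  by rewrite epsK ler_piMl ?exprn_ge0// ltW.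
have rescale (z k j : R) : j <= K -> `|z - mu * k| <= mu * (j * (2 * dl + L^-1 + eps ^+ 4)) ->
    exists2 i, z = mu * (k + i) & `|i| <= eps ^+ 3 / 100.
  move=> jK h; exists (z / mu - k); first by rewrite addrC subrK mulrC mulfVK// gt_eqF.
  apply: le_trans (err _ jK); rewrite -(ler_pM2l mu0); apply: le_trans h.
  by rewrite -{1}(gtr0_norm mu0) -normrM mulrBr mulrCA mulfV ?mulr1// gt_eqF.
have n0' := ltW n0.
have [i eI hi] : exists2 i, fisherF L eps q n 0 = mu * (6 * eps ^+ 2 - 3 * eps ^+ 3 + i) &
    `|i| <= eps ^+ 3 / 100.
  rewrite -calI_dens// /calI calI_integrandE//.
  apply: (@rescale _ _ KI); first by rewrite /K; lra.
  apply: (density_estimate L2 eps0 eps1 dl0 dlL (low := fun m => 2 * (1 + m AS * phiv m))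
    (A := fluxXI) (B := fluxYI q) (rem := remI q)) => //.
    exact: ltW.
  by move=> m mi <-; rewrite densityI.
have [k eQ hk] : exists2 k, hessF L eps q n 0 = mu * (24 * eps ^+ 2 - 18 * eps ^+ 3 + k) &
    `|k| <= eps ^+ 3 / 100.
  apply: (@rescale _ _ KQ); first by rewrite /K; lra.
  apply: (density_estimate L2 eps0 eps1 dl0 dlL (low := lowQ q)
    (A := fluxXQ) (B := fluxYQ q) (rem := remQ q)) => //.
    exact: ltW.
  by move=> m mi <-; rewrite densityQ.
have [d eD hd] : exists2 d, dissF L eps q n 0 = mu * (96 * eps ^+ 2 - 108 * eps ^+ 3 + d) &
    `|d| <= eps ^+ 3 / 100.
  apply: (@rescale _ _ KD); first by rewrite /K; lra.
  apply: (density_estimate L2 eps0 eps1 dl0 dlL (low := lowD q)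
    (A := fluxXD) (B := fluxYD q) (rem := remD q)) => //.
    exact: ltW.
  by move=> m mi <-; rewrite densityD.
rewrite eI eQ eD [ltLHS](_ : _ = mu ^+ 2 *
  ((6 * eps ^+ 2 - 3 * eps ^+ 3 + i) * (96 * eps ^+ 2 - 108 * eps ^+ 3 + d) -
   (24 * eps ^+ 2 - 18 * eps ^+ 3 + k) ^+ 2)); last by ring.
rewrite pmulr_rlt0 ?exprn_gt0//.
exact: leading_terms_lt0.
Qed.
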